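(* Let $k$ be a field and let $V,W$ be finite dimensional $k$-linear spaces. If $u\in\mathcal L(V)\otimes\mathcal L(W)$ is invertible and if the equality $$(t\otimes id)u^{-1}=((t\otimes id)u)^{-1}$$ holds in $\mathcal L(V^* )\otimes\mathcal L(W)$ (in particular $(t\otimes id)u$ is invertible), then there exists a minimal model for $u$. This is the unique bi-faithful model for $u$.
   Context: All $k$-algebras are unital with unital morphisms; all coalgebras are counital with counital morphisms. $\mathcal L(V)$ is the algebra of $k$-linear endomorphisms of $V$, tensor products are over $k$, and $t:\mathcal L(V)\to\mathcal L(V^* )$ is the transposition, $t(T)(f)=f\circ T$. Subscripts such as $v_{12},v_{13}$ are the usual leg-numbering notation. Let $(H,m,1,\Delta,\varepsilon,S)$ be a Hopf $k$-algebra. $H^\circ\subset H^*$ denotes the finite dual (linear forms whose kernel contains a finite-codimensional ideal), a Hopf algebra with the structure dual to that of $H$. A (finite dimensional) representation of $H$ is a morphism of algebras $\pi:H\to\mathcal L(W)$; its space of coefficients is the subcoalgebra $\mathcal C_\pi=\{f\circ\pi\mid f\in\mathcal L(W)^*\}\subset H^\circ$. A (finite dimensional) corepresentation of $H$ is an element $v\in\mathcal L(V)\otimes H$ with $(id\otimes\Delta)v=v_{12}v_{13}$ and $(id\otimes\varepsilon)v=1$; its space of coefficients is the subcoalgebra $\mathcal C_v=\{(f\otimes id)v\mid f\in\mathcal L(V)^*\}\subset H$. For a subcoalgebra $C$ of a Hopf algebra with antipode $S$, $\langle C\rangle$ is the unital subalgebra generated by $\bigcup_{k\ge0}S^k(C)$.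 A model for $u\in\mathcal L(V)\otimes\mathcal L(W)$ is a triple $(H,v,\pi)$ with $H$ a Hopf $k$-algebra, $v\in\mathcal L(V)\otimes H$ a corepresentation and $\pi:H\to\mathcal L(W)$ a representation such that $(id\otimes\pi)v=u$. The model is left-faithful if $\langle\mathcal C_v\rangle=H$; right-faithful if $\langle\mathcal C_\pi\rangle\subset H^\circ$ is dense in $H^*$, i.e. the only $h\in H$ with $f(h)=0$ for all $f\in\langle\mathcal C_\pi\rangle$ is $h=0$; bi-faithful if both. A morphism of left-faithful models $(H_1,v_1,\pi_1)\to(H_2,v_2,\pi_2)$ of $u$ is a Hopf algebra morphism $f:H_1\to H_2$ with $(id\otimes f)v_1=v_2$ and $\pi_1=\pi_2f$. The minimal model for $u$ is the universally attracting (terminal) object of the category of left-faithful models for $u$. Uniqueness of models is understood up to isomorphism of left-faithful models. *)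

(* Defs.v *)
From HB Require Import structures.
From mathcomp Require Import all_boot generic_quotient ssralg vector.
From mathcomp Require Import boolp classical_sets.

Set Implicit Arguments.
Unset Strict Implicit.
Unset Printing Implicit Defensive.

Import GRing.Theory.
Local Open Scope ring_scope.
Local Open Scope quotient_scope.

(** * Tensor products over a field *)

Section Tensor.
Variables (k : fieldType) (A B : lmodType k).

Definition bilinear_map (C : lmodType k) (f : A -> B -> C) : Prop :=
  (forall x, linear (f x)) /\ (forall y, linear (f^~ y)).

(* A list [:: (a_1, b_1); ...; (a_n, b_n)] stands for the formal sum of the
   a_i (x) b_i; scalars are absorbed in the a_i. *)
Definition eval_sum (C : lmodType k) (f : A -> B -> C) (s : seq (A * B)) : C :=
  \sum_(p <- s) f p.1 p.2.

(* Two formal sums are equal in A (x) B iff no bilinear map separates them. *)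
Definition tensor_rel (s t : seq (A * B)) : bool :=
  `[< forall (C : lmodType k) (f : A -> B -> C),
        bilinear_map f -> eval_sum f s = eval_sum f t >].

Lemma tensor_rel_refl : reflexive tensor_rel.
Proof. by move=> s; apply/asboolP. Qed.

Lemma tensor_rel_sym : symmetric tensor_rel.
Proof. by move=> s t; apply/asboolP/asboolP => h C f /h ->. Qed.

Lemma tensor_rel_trans : transitive tensor_rel.
Proof.
move=> t s r /asboolP h1 /asboolP h2; apply/asboolP => C f hf.
by rewrite h1 // h2.
Qed.

Canonical tensor_rel_equiv :=
  EquivRel tensor_rel tensor_rel_refl tensor_rel_sym tensor_rel_trans.

Definition tensor : Type := {eq_quot tensor_rel}.
HB.instance Definition _ := Choice.on tensor.
HB.instance Definition _ := EqQuotient.on tensor.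

Definition pure (a : A) (b : B) : tensor := \pi_tensor [:: (a, b)].

(* The map A (x) B -> C induced by f; it is meaningful for bilinear f only,
   see tlift_pure and tlift_linear below. *)
Definition tlift (C : lmodType k) (f : A -> B -> C) (t : tensor) : C :=
  eval_sum f (repr t).

Lemma tlift_pi C f s : @bilinear_map C f ->
  tlift f (\pi_tensor s) = eval_sum f s.
Proof.
move=> hf; rewrite /tlift; case: piP => t /eqmodP /asboolP h.
by rewrite h.
Qed.

Lemma tensor_eqP (s t : seq (A * B)) :
  \pi_tensor s = \pi_tensor t <->
  (forall (C : lmodType k) (f : A -> B -> C),
     bilinear_map f -> eval_sum f s = eval_sum f t).
Proof. by split=> [/eqmodP /asboolP|h]; last by apply/eqmodP/asboolP. Qed.

Lemma tlift_inj (x y : tensor) :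
  (forall (C : lmodType k) (f : A -> B -> C),
     bilinear_map f -> tlift f x = tlift f y) -> x = y.
Proof.
move=> h; rewrite -(reprK x) -(reprK y).
by apply/tensor_eqP => C f /h.
Qed.

Let scale1 (c : k) (s : seq (A * B)) := [seq (c *: p.1, p.2) | p <- s].

Definition tensor_zero : tensor := \pi_tensor [::].
Definition tensor_add (x y : tensor) : tensor := \pi_tensor (repr x ++ repr y).
Definition tensor_scale (c : k) (x : tensor) : tensor :=
  \pi_tensor (scale1 c (repr x)).
Definition tensor_opp (x : tensor) : tensor := tensor_scale (-1) x.

Lemma linear_scale0 (U C : lmodType k) (f : U -> C) :
  linear f -> (f 0 = 0) * (forall c a, f (c *: a) = c *: f a)
  * (forall a b, f (a + b) = f a + f b).
Proof.
move=> hf; have f0 : f 0 = 0.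
  by have := hf (-1) 0 0; rewrite scaler0 addr0 scaleN1r addNr.
split; first split=> // c a; first by have := hf c a 0; rewrite f0 !addr0.
by move=> a b; have := hf 1 a b; rewrite !scale1r.
Qed.

Lemma tlift0 C f : @bilinear_map C f -> tlift f tensor_zero = 0.
Proof. by move=> hf; rewrite tlift_pi // /eval_sum big_nil. Qed.

Lemma tliftD C f x y : @bilinear_map C f ->
  tlift f (tensor_add x y) = tlift f x + tlift f y.
Proof. by move=> hf; rewrite tlift_pi // /eval_sum big_cat. Qed.

Lemma tliftZ C f c x : @bilinear_map C f ->
  tlift f (tensor_scale c x) = c *: tlift f x.
Proof.
move=> hf; rewrite tlift_pi // /tlift /eval_sum big_map scaler_sumr.
by apply: eq_bigr => p _ /=; case: hf => _ /(_ p.2) /linear_scale0 ->.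
Qed.

Lemma tliftN C f x : @bilinear_map C f ->
  tlift f (tensor_opp x) = - tlift f x.
Proof. by move=> hf; rewrite tliftZ // scaleN1r. Qed.

Let tE := (tliftD, tlift0, tliftN, tliftZ).

Fact tensor_addA : associative tensor_add.
Proof. by move=> x y z; apply: tlift_inj => C f hf; rewrite !tE // addrA. Qed.
Fact tensor_addC : commutative tensor_add.
Proof. by move=> x y; apply: tlift_inj => C f hf; rewrite !tE // addrC. Qed.
Fact tensor_add0 : left_id tensor_zero tensor_add.
Proof. by move=> x; apply: tlift_inj => C f hf; rewrite !tE // add0r. Qed.
Fact tensor_addN : left_inverse tensor_zero tensor_opp tensor_add.
Proof. by move=> x; apply: tlift_inj => C f hf; rewrite !tE // addNr. Qed.
HB.instance Definition _ := GRing.isZmodule.Build tensor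
  tensor_addA tensor_addC tensor_add0 tensor_addN.

Fact tensor_scaleA a b x :
  tensor_scale a (tensor_scale b x) = tensor_scale (a * b) x.
Proof. by apply: tlift_inj => C f hf; rewrite !tE // scalerA. Qed.
Fact tensor_scale1 : left_id 1 tensor_scale.
Proof. by move=> x; apply: tlift_inj => C f hf; rewrite !tE // scale1r. Qed.
Fact tensor_scaleDr : right_distributive tensor_scale +%R.
Proof. by move=> a x y; apply: tlift_inj => C f hf; rewrite !tE // scalerDr. Qed.
Fact tensor_scaleDl x : {morph tensor_scale^~ x : a b / a + b}.
Proof. by move=> a b; apply: tlift_inj => C f hf; rewrite !tE // scalerDl. Qed.
HB.instance Definition _ := GRing.Zmodule_isLmodule.Build k tensor
  tensor_scaleA tensor_scale1 tensor_scaleDr tensor_scaleDl.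

Lemma tlift_linear C f : @bilinear_map C f -> linear (tlift f).
Proof. by move=> hf c x y; rewrite -[RHS]/(_ + _) -tliftZ // -tliftD. Qed.

Lemma tlift_pure C f a b : @bilinear_map C f -> tlift f (pure a b) = f a b.
Proof. by move=> hf; rewrite tlift_pi // /eval_sum big_seq1. Qed.

Lemma pure_bilinear : bilinear_map pure.
Proof.
split=> [x|y] c a b; apply: tlift_inj => C f hf;
  rewrite (tlift_linear hf) !tlift_pure //; first by case: hf => /(_ x) ->.
by case: hf => _ /(_ y) ->.
Qed.

Lemma tensor_sum_pure (x : tensor) :
  x = \sum_(p <- repr x) pure p.1 p.2.
Proof.
apply: tlift_inj => C f hf.
have /linear_scale0 [[l0 _] lD] := tlift_linear hf.
rewrite (big_morph _ lD l0) /tlift [LHS]/eval_sum.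
by apply: eq_bigr => p _; rewrite -/(tlift _ _) tlift_pure.
Qed.

Lemma tensor_linear_eq (C : lmodType k) (f g : tensor -> C) :
  linear f -> linear g -> (forall a b, f (pure a b) = g (pure a b)) -> f =1 g.
Proof.
move=> /linear_scale0 [[f0 _] fD] /linear_scale0 [[g0 _] gD] fg x.
rewrite (tensor_sum_pure x) (big_morph _ fD f0) (big_morph _ gD g0).
by apply: eq_bigr => p _.
Qed.

End Tensor.

Lemma comp_bilinear (k : fieldType) (A B C D : lmodType k)
    (f : A -> B -> C) (g : C -> D) :
  bilinear_map f -> linear g -> bilinear_map (fun a b => g (f a b)).
Proof.
by case=> f1 f2 hg; split=> [x|y] c a b; [rewrite f1|rewrite /= f2]; rewrite hg.
Qed.

Definition tmap (k : fieldType) (A B A' B' : lmodType k)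
    (f : A -> A') (g : B -> B') : tensor A B -> tensor A' B' :=
  tlift (fun a b => pure (f a) (g b)).

Definition tassoc (k : fieldType) (A B C : lmodType k) :
    tensor (tensor A B) C -> tensor A (tensor B C) :=
  tlift (fun t c => tlift (fun a b => pure a (pure b c)) t).

Section TensorMaps.
Variable k : fieldType.

Lemma pure_comp_bilinear (A B A' B' : lmodType k) (f : A -> A') (g : B -> B') :
  linear f -> linear g -> bilinear_map (fun a b => pure (f a) (g b)).
Proof.
case: (pure_bilinear A' B') => p1 p2 hf hg.
by split=> [x|y] c a b; [rewrite hg p1|rewrite /= hf p2].
Qed.

Lemma tmap_linear (A B A' B' : lmodType k) (f : A -> A') (g : B -> B') :
  linear f -> linear g -> linear (tmap f g).
Proof. by move=> hf hg; apply/tlift_linear/pure_comp_bilinear. Qed.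

Lemma tmap_pure (A B A' B' : lmodType k) (f : A -> A') (g : B -> B') a b :
  linear f -> linear g -> tmap f g (pure a b) = pure (f a) (g b).
Proof.
by move=> hf hg; rewrite /tmap tlift_pure //; apply: pure_comp_bilinear.
Qed.

Lemma tlift_bilinear2 (A B X Y C : lmodType k) (F : A -> B -> X -> Y -> C) :
  (forall a b, bilinear_map (F a b)) ->
  (forall x y, bilinear_map (fun a b => F a b x y)) ->
  forall t, bilinear_map (fun a b => tlift (F a b) t).
Proof.
move=> h1 h2 t; split=> [a|b] c u v; rewrite /tlift /eval_sum scaler_sumr;
  rewrite -big_split; apply: eq_bigr => p _ /=.
  by case: (h2 p.1 p.2) => -> _.
by case: (h2 p.1 p.2) => _ ->.
Qed.

Lemma tassoc_bilinear (A B C : lmodType k) : bilinear_map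
  (fun (t : tensor A B) (c : C) => tlift (fun a b => pure a (pure b c)) t).
Proof.
have h (c : C) : bilinear_map (fun (a : A) (b : B) => pure a (pure b c)).
  have [p1 p2] := pure_bilinear A (tensor B C).
  have [_ q2] := pure_bilinear B C.
  by split=> [a|b] e x y; [rewrite q2 p1|rewrite /= p2].
split=> [t|c]; last exact/tlift_linear.
move=> e x y; rewrite /tlift /eval_sum scaler_sumr -big_split.
apply: eq_bigr => p _ /=.
have [p1 _] := pure_bilinear A (tensor B C).
by have [q1 _] := pure_bilinear B C; rewrite q1 p1.
Qed.

Lemma tassoc_pure (A B C : lmodType k) (a : A) (b : B) (c : C) :
  tassoc (pure (pure a b) c) = pure a (pure b c).
Proof.
rewrite /tassoc (tlift_pure _ _ (@tassoc_bilinear A B C)) tlift_pure //.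
have [p1 p2] := pure_bilinear A (tensor B C).
have [_ q2] := pure_bilinear B C.
by split=> [x|y] e u v; [rewrite q2 p1|rewrite /= p2].
Qed.

End TensorMaps.


(** * Products on tensor products *)

(* The product (a (x) b)(a' (x) b') = m a a' (x) n b b'.  The products of the
   factors are explicit arguments because an endomorphism algebra 'End(V) may be
   zero, so that it is no GRing.Algebra; its product is comp_lfun (the product
   that falgebra puts on 'End(V) is the opposite one). *)
Definition tmul (k : fieldType) (A B : lmodType k)
    (m : A -> A -> A) (n : B -> B -> B) (x y : tensor A B) : tensor A B :=
  tlift (fun a b => tlift (fun a' b' => pure (m a a') (n b b')) y) x.

Section TensorProduct.
Variables (k : fieldType) (A B : lmodType k).
Variables (m : A -> A -> A) (n : B -> B -> B).
Hypotheses (mB : bilinear_map m) (nB : bilinear_map n).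

Let mulF1 a b : bilinear_map (fun a' b' => pure (m a a') (n b b')).
Proof. by case: mB nB => ? _ [? _]; apply: pure_comp_bilinear. Qed.
Let mulF2 a' b' : bilinear_map (fun a b => pure (m a a') (n b b')).
Proof.
by case: mB nB => _ h1 [_ h2]; apply: pure_comp_bilinear; [apply: h1|apply: h2].
Qed.

Lemma tmul_pure a b a' b' :
  tmul m n (pure a b) (pure a' b') = pure (m a a') (n b b').
Proof.
by rewrite /tmul tlift_pure ?tlift_pure //; apply: tlift_bilinear2.
Qed.

Lemma tmul_bilinear : bilinear_map (tmul m n).
Proof.
split=> [x|y]; last by apply/tlift_linear/tlift_bilinear2.
move=> c u v; rewrite /tmul /tlift /eval_sum scaler_sumr -big_split.
by apply: eq_bigr => p _; apply: (tlift_linear (mulF1 p.1 p.2)).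
Qed.

End TensorProduct.

Lemma mulr_bilinear (k : fieldType) (A : algType k) :
  bilinear_map (fun x y : A => x * y).
Proof.
split=> [x|y] c a b; first by rewrite mulrDr scalerAr.
by rewrite mulrDl scalerAl.
Qed.

Lemma comp_lfun_bilinear (k : fieldType) (V : vectType k) :
  bilinear_map (fun f g : 'End(V) => (f \o g)%VF).
Proof.
split=> [f|g] c a b; first by rewrite comp_lfunDr -comp_lfunZr.
by rewrite comp_lfunDl -comp_lfunZl.
Qed.

(** * Transposition *)

Definition vdual (k : fieldType) (V : vectType k) : vectType k := 'Hom(V, k^o).

Definition transpose (k : fieldType) (V : vectType k) (T : 'End(V)) :
    'End(vdual V) :=
  linfun (fun f : vdual V => (f \o T)%VF).

Lemma transposeE (k : fieldType) (V : vectType k) (T : 'End(V)) (f : vdual V) :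
  transpose T f = (f \o T)%VF.
Proof.
pose g (f : vdual V) : vdual V := (f \o T)%VF.
have gL : linear g.
  by move=> c x y; rewrite /g comp_lfunDl -comp_lfunZl.
pose gl := HB.pack_for {linear vdual V -> vdual V} g
  (GRing.isLinear.Build k _ _ _ g gL).
exact: (lfunE gl).
Qed.

(** * Hopf algebras *)

(* The condition 1 != 0 contained in GRing.Algebra is no restriction here, since
   the counit maps 1 to 1 != 0. *)
HB.mixin Record Algebra_isHopf (k : fieldType) H of GRing.Algebra k H := {
  comul : {linear H -> tensor H H};
  counit : {lrmorphism H -> k^o};
  antipode : {linear H -> H};
  comul1 : comul 1 = pure 1 1;
  comulM : forall x y, comul (x * y) = tmul *%R *%R (comul x) (comul y);
  comulA : forall h,
    tassoc (tmap comul idfun (comul h)) = tmap idfun comul (comul h);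
  counitl : forall h, tlift (fun x y : H => counit x *: y) (comul h) = h;
  counitr : forall h, tlift (fun x y : H => counit y *: x) (comul h) = h;
  antipodel : forall h,
    tlift (fun x y : H => antipode x * y) (comul h) = (counit h)%:A;
  antipoder : forall h,
    tlift (fun x y : H => x * antipode y) (comul h) = (counit h)%:A
}.

#[short(type="hopfType")]
HB.structure Definition Hopf (k : fieldType) :=
  {H of Algebra_isHopf k H & GRing.Algebra k H}.

Definition hopf_morphism (k : fieldType) (H K : hopfType k)
    (f : {lrmorphism H -> K}) : Prop :=
  [/\ forall h, comul (f h) = tmap f f (comul h),
      forall h, counit (f h) = counit h
    & forall h, antipode (f h) = f (antipode h)].

(** * The convolution algebra of linear forms *)

Definition dual (k : fieldType) (U : lmodType k) : Type := {linear U -> k^o}.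
HB.instance Definition _ (k : fieldType) (U : lmodType k) := gen_eqMixin (dual U).
HB.instance Definition _ (k : fieldType) (U : lmodType k) :=
  gen_choiceMixin (dual U).

Definition dual_of (k : fieldType) (U : lmodType k) (f : U -> k^o)
    (fL : linear f) : dual U :=
  HB.pack_for {linear U -> k^o} f (GRing.isLinear.Build k U k^o *:%R f fL).

Section Dual.
Variables (k : fieldType) (U : lmodType k).
Implicit Types f g h : dual U.

Lemma dual_ext f g : f =1 g -> f = g.
Proof.
case: f g => [f [[f1] [f2]]] [g [[g1] [g2]]] /= /funext fg.
case: _ / fg in g1 g2 *.
by rewrite (Prop_irrelevance f1 g1) (Prop_irrelevance f2 g2).
Qed.

Fact dual_add_linear f g : linear (fun x => f x + g x).
Proof. by move=> c x y; rewrite !linearP scalerDr addrACA. Qed.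
Fact dual_scale_linear c f : linear (fun x => c *: f x).
Proof.
by move=> d x y; rewrite linearP scalerDr !scalerA [c * d]mulrC.
Qed.
Fact dual_zero_linear : linear (fun _ : U => 0 : k^o).
Proof. by move=> c x y; rewrite scaler0 addr0. Qed.

Definition dual_zero : dual U := dual_of dual_zero_linear.
Definition dual_add f g : dual U := dual_of (dual_add_linear f g).
Definition dual_scale c f : dual U := dual_of (dual_scale_linear c f).
Definition dual_opp f : dual U := dual_scale (-1) f.

Fact dual_addA : associative dual_add.
Proof. by move=> f g h; apply: dual_ext => x; apply: addrA. Qed.
Fact dual_addC : commutative dual_add.
Proof. by move=> f g; apply: dual_ext => x; apply: addrC. Qed.
Fact dual_add0 : left_id dual_zero dual_add.
Proof. by move=> f; apply: dual_ext => x; apply: add0r. Qed.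
Fact dual_addN : left_inverse dual_zero dual_opp dual_add.
Proof.
by move=> f; apply: dual_ext => x; rewrite /= scaleN1r addNr.
Qed.
HB.instance Definition _ := GRing.isZmodule.Build (dual U)
  dual_addA dual_addC dual_add0 dual_addN.

Fact dual_scaleA a b f : dual_scale a (dual_scale b f) = dual_scale (a * b) f.
Proof. by apply: dual_ext => x; apply: scalerA. Qed.
Fact dual_scale1 : left_id 1 dual_scale.
Proof. by move=> f; apply: dual_ext => x; apply: scale1r. Qed.
Fact dual_scaleDr : right_distributive dual_scale +%R.
Proof. by move=> a f g; apply: dual_ext => x; apply: scalerDr. Qed.
Fact dual_scaleDl f : {morph dual_scale^~ f : a b / a + b}.
Proof. by move=> a b; apply: dual_ext => x; apply: scalerDl. Qed.
HB.instance Definition _ := GRing.Zmodule_isLmodule.Build k (dual U)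
  dual_scaleA dual_scale1 dual_scaleDr dual_scaleDl.

End Dual.

Section Convolution.
Variables (k : fieldType) (H : hopfType k).
Implicit Types f g : dual H.

Let pairing f g (x y : H) : k^o := f x * g y.
Let pairing_bilinear f g : bilinear_map (pairing f g).
Proof.
split=> [x|y] c a b; rewrite /pairing linearP.
  by rewrite mulrDr; congr (_ + _); apply: mulrCA.
by rewrite mulrDl -scalerAl.
Qed.

Fact conv_linear f g : linear (fun h => tlift (pairing f g) (comul h)).
Proof.
by move=> c x y; rewrite linearP; apply: tlift_linear.
Qed.
Definition conv f g : dual H := dual_of (conv_linear f g).
Definition conv_one : dual H := counit.

Let pairing3 f g h : tensor H (tensor H H) -> k^o :=
  tlift (fun a t => f a * tlift (pairing g h) t).

Let pairing3_bilinear f g h :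
  bilinear_map (fun a (t : tensor H H) => f a * tlift (pairing g h) t : k^o).
Proof.
split=> [x|y] c a b.
  rewrite (tlift_linear (pairing_bilinear g h)) mulrDr.
  by congr (_ + _); apply: mulrCA.
by rewrite /= linearP mulrDl -scalerAl.
Qed.

Let tassoc_linear : linear (@tassoc k H H H).
Proof. exact/tlift_linear/tassoc_bilinear. Qed.

Let comul_linear : linear (@comul k H). Proof. exact: linearP. Qed.

Fact conv_mulA : associative conv.
Proof.
move=> f g h; apply: dual_ext => x /=.
have id_lin : linear (@idfun H) by [].
have p3L : linear (pairing3 f g h) := tlift_linear (pairing3_bilinear f g h).
have [pl pr] := pure_bilinear (tensor H H) H.
have -> : tlift (pairing f (conv g h)) (comul x) =
          pairing3 f g h (tmap idfun comul (comul x)).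
  move: (comul x); apply: tensor_linear_eq.
  - exact/tlift_linear/pairing_bilinear.
  - by move=> c u v; rewrite (tmap_linear id_lin comul_linear) p3L.
  move=> a b; rewrite (tlift_pure _ _ (pairing_bilinear _ _)).
  rewrite (tmap_pure _ _ id_lin comul_linear).
  by rewrite /pairing3 (tlift_pure _ _ (pairing3_bilinear _ _ _)).
rewrite -comulA; move: (comul x); apply: tensor_linear_eq.
- move=> c u v.
  by rewrite (tmap_linear comul_linear id_lin) tassoc_linear p3L.
- exact/tlift_linear/pairing_bilinear.
move=> a b; rewrite (tlift_pure _ _ (pairing_bilinear _ _)).
rewrite (tmap_pure _ _ comul_linear id_lin) /= {1}/pairing /=.
move: (comul a); apply: tensor_linear_eq.
- by move=> c u v; rewrite pr tassoc_linear p3L.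
- move=> c u v; rewrite (tlift_linear (pairing_bilinear f g)) mulrDl.
  by rewrite -scalerAl.
move=> a1 a2; rewrite tassoc_pure.
rewrite /pairing3 (tlift_pure _ _ (pairing3_bilinear _ _ _)).
by rewrite !(tlift_pure _ _ (pairing_bilinear _ _)) mulrA.
Qed.

Fact conv_mul1l : left_id conv_one conv.
Proof.
move=> f; apply: dual_ext => x /=; rewrite -[in RHS](counitl x).
have e_bil : bilinear_map (fun a b : H => (counit a : k) *: b).
  split=> [a|b] c u v; last by rewrite linearP scalerDl scalerA.
  by rewrite scalerDr !scalerA [_ * c]mulrC.
move: (comul x); apply: tensor_linear_eq => [|c u v|a b].
- exact/tlift_linear/pairing_bilinear.
- by rewrite (tlift_linear e_bil) linearP.
by rewrite (tlift_pure _ _ (pairing_bilinear _ _)) (tlift_pure _ _ e_bil) linearZ.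
Qed.

Fact conv_mul1r : right_id conv_one conv.
Proof.
move=> f; apply: dual_ext => x /=; rewrite -[in RHS](counitr x).
have e_bil : bilinear_map (fun a b : H => (counit b : k) *: a).
  split=> [a|b] c u v; first by rewrite linearP scalerDl scalerA.
  by rewrite scalerDr !scalerA [_ * c]mulrC.
move: (comul x); apply: tensor_linear_eq => [|c u v|a b].
- exact/tlift_linear/pairing_bilinear.
- by rewrite (tlift_linear e_bil) linearP.
rewrite (tlift_pure _ _ (pairing_bilinear _ _)) (tlift_pure _ _ e_bil) linearZ.
exact: mulrC.
Qed.

Fact conv_bilinear : bilinear_map conv.
Proof.
split=> [f|g] c u v; apply: dual_ext => x /=;
  rewrite /tlift /eval_sum scaler_sumr -big_split; apply: eq_bigr => p _ /=;
  rewrite /pairing /=.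
  by rewrite mulrDr; congr (_ + _); apply: mulrCA.
by rewrite mulrDl -scalerAl.
Qed.

Fact conv_mulDl : left_distributive conv +%R.
Proof.
by move=> f g h; have [_ /(_ h 1 f g)] := conv_bilinear; rewrite /= !scale1r.
Qed.
Fact conv_mulDr : right_distributive conv +%R.
Proof.
by move=> f g h; have [/(_ f 1 g h)] := conv_bilinear; rewrite /= !scale1r.
Qed.
Fact conv_one_neq0 : conv_one != 0.
Proof.
apply/eqP => e0; have : conv_one 1 = 0 by rewrite e0.
by move/eqP; rewrite /= rmorph1 oner_eq0.
Qed.
HB.instance Definition _ := GRing.Zmodule_isNzRing.Build (dual H)
  conv_mulA conv_mul1l conv_mul1r conv_mulDl conv_mulDr conv_one_neq0.

Fact conv_scaleAl c f g : c *: (f * g) = (c *: f) * g.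
Proof.
by have [_ /(_ g)/linear_scale0 [[_ /(_ c f) e] _]] := conv_bilinear.
Qed.
Fact conv_scaleAr c f g : c *: (f * g) = f * (c *: g).
Proof.
by have [/(_ f)/linear_scale0 [[_ /(_ c g) e] _]] := conv_bilinear.
Qed.
HB.instance Definition _ :=
  GRing.Lmodule_isLalgebra.Build k (dual H) conv_scaleAl.
HB.instance Definition _ :=
  GRing.Lalgebra_isAlgebra.Build k (dual H) conv_scaleAr.

Fact dual_antipode_linear f : linear (fun h => f (antipode h)).
Proof. by move=> c x y; rewrite !linearP. Qed.
Definition dual_antipode f : dual H := dual_of (dual_antipode_linear f).

End Convolution.

Lemma dual_mulE (k : fieldType) (H : hopfType k) (f g : dual H) (h : H) :
  (f * g) h = tlift (fun x y => f x * g y : k^o) (comul h).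
Proof. by []. Qed.

Lemma dual_oneE (k : fieldType) (H : hopfType k) (h : H) :
  (1 : dual H) h = counit h.
Proof. by []. Qed.

(** * Subalgebras generated by subcoalgebras *)

Local Open Scope classical_set_scope.

Inductive subalg_gen (k : fieldType) (A : algType k) (X : set A) : set A :=
| subalg_gen_in x : X x -> subalg_gen X x
| subalg_gen_one : subalg_gen X 1
| subalg_gen_add x y : subalg_gen X x -> subalg_gen X y -> subalg_gen X (x + y)
| subalg_gen_scale c x : subalg_gen X x -> subalg_gen X (c *: x)
| subalg_gen_mul x y : subalg_gen X x -> subalg_gen X y -> subalg_gen X (x * y).

Definition hopf_gen (k : fieldType) (A : algType k) (S : A -> A) (C : set A) :
    set A :=
  subalg_gen (\bigcup_(n in [set: nat]) (iter n S @` C)).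

(** * Representations, corepresentations and models *)

Definition leg12 (k : fieldType) (A : lmodType k) (H : algType k) :
    tensor A H -> tensor A (tensor H H) :=
  tmap idfun (fun h => pure h 1).

Definition leg13 (k : fieldType) (A : lmodType k) (H : algType k) :
    tensor A H -> tensor A (tensor H H) :=
  tmap idfun (fun h => pure 1 h).

Definition inverse_of (k : fieldType) (V W : vectType k)
    (u v : tensor 'End(V) 'End(W)) : Prop :=
  let mul := tmul (@comp_lfun _ V V V) (@comp_lfun _ W W W) in
  mul u v = pure \1%VF \1%VF /\ mul v u = pure \1%VF \1%VF.

Section Models.
Variables (k : fieldType) (V W : vectType k).

Definition representation (H : algType k) (pi : {linear H -> 'End(W)}) : Prop :=
  pi 1 = \1%VF /\ forall x y, pi (x * y) = (pi x \o pi y)%VF.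

(* The identities (id (x) comul) v = v_12 v_13 and (id (x) counit) v = 1. *)
Definition corepresentation (H : hopfType k) (v : tensor 'End(V) H) : Prop :=
  tmap idfun comul v =
    tmul (@comp_lfun _ V V V) (tmul *%R *%R) (leg12 v) (leg13 v)
  /\ tmap idfun counit v = pure \1%VF 1.

Definition rep_coef (H : hopfType k) (pi : {linear H -> 'End(W)}) :
    set (dual H) :=
  [set g | exists f : dual 'End(W), forall h, g h = f (pi h)].

Definition corep_coef (H : hopfType k) (v : tensor 'End(V) H) : set H :=
  [set x | exists f : dual 'End(V), x = tlift (fun T h => (f T : k) *: h) v].

Record model (u : tensor 'End(V) 'End(W)) := Model {
  model_hopf : hopfType k;
  model_corep : tensor 'End(V) model_hopf;
  model_rep : {linear model_hopf -> 'End(W)};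
  model_corepP : corepresentation model_corep;
  model_repP : representation model_rep;
  modelE : tmap idfun model_rep model_corep = u
}.

Variable u : tensor 'End(V) 'End(W).
Implicit Types M N : model u.

Definition left_faithful M : Prop :=
  hopf_gen antipode (corep_coef (model_corep M)) = [set: model_hopf M].

(* The finite dual of H is a subalgebra of the convolution algebra of linear
   forms on H, it contains the coefficients of pi, and its antipode is the
   transpose of that of H; hence the subalgebra of it that they generate can be
   formed in the full dual. *)
Definition right_faithful M : Prop :=
  forall h : model_hopf M,
    (forall f, hopf_gen (@dual_antipode k (model_hopf M))
                 (rep_coef (model_rep M)) f -> f h = 0) ->
    h = 0.

Definition bi_faithful M : Prop := left_faithful M /\ right_faithful M.

Definition model_morphism M N
    (f : {lrmorphism model_hopf M -> model_hopf N}) : Prop :=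
  [/\ hopf_morphism f,
      tmap idfun f (model_corep M) = model_corep N
    & forall h, model_rep M h = model_rep N (f h)].

Definition model_iso M N : Prop :=
  exists (f : {lrmorphism model_hopf M -> model_hopf N})
         (g : {lrmorphism model_hopf N -> model_hopf M}),
    [/\ model_morphism f, model_morphism g, cancel f g & cancel g f].

Definition minimal_model M : Prop :=
  left_faithful M /\
  forall N, left_faithful N ->
    exists2 f : {lrmorphism model_hopf N -> model_hopf M},
      model_morphism f &
      forall g : {lrmorphism model_hopf N -> model_hopf M},
        model_morphism g -> g =1 f.

End Models.

(* Main.v *)
Require Import Defs.
From HB Require Import structures.
From mathcomp Require Import all_boot ssralg zmodp matrix vector.
From mathcomp Require Import boolp classical_sets functions.

Set Implicit Arguments.
Unset Strict Implicit.
Unset Printing Implicit Defensive.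

Import GRing.Theory VectorInternalTheory.
Local Open Scope ring_scope.

(** In coordinates [u] is a matrix [(u_ij)] over [End(W)]. In a model
    [(H, v, pi)] the image of [v] under [pi] is [u], so that [S v] goes to the
    inverse of [u]; the entries of [S^2 v] satisfy the transposed inversion
    formula, and the hypothesis on transposes says that they go to [u] again.
    All the linear forms on [H] built from [pi] and [S] are therefore known on
    [v] once [u] is known.

    This is made precise by words in letters [(e, p, q)]. A letter stands for
    the linear form [h |-> pi(h)_pq] if [e] is false, [h |-> pi(S h)_qp] if [e]
    is true, and a word for the convolution product of its letters. Thus each
    element of [H] becomes a function on words, [to_words]. On the entries of
    [v] it is [w |-> rho_word w], the product of matrices [rho l] whose entries
    are those of [u] and of its inverse.

    This suggests as terminal model the algebra [coef_alg] generated, among all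
    functions on words, by the functions [w |-> rho_word w i j] and their
    antipodes. The product of functions is dual to the coproduct
    [(e, p, q) |-> \sum_r (e, p, r) (x) (e, r, q)] of letters, the coproduct is
    dual to concatenation, and the antipode to the reversal of words combined
    with [(e, p, q) |-> (~~ e, q, p)]. The coproduct exists because it does on
    the generators, and is well defined and coassociative because evaluations
    at words separate tensors ([tensor_separated]). The antipode law has to be
    checked on generators only, and there it amounts to the inversion formulas
    for [u] and for its transpose ([genmx_mulE], [genmx_mul_trE]). Evaluation at
    a word lies in the algebra generated by the coefficients of the
    representation and their antipodes, so that this model is right-faithful;
    it is left-faithful by construction.

    Given a left-faithful model, [to_words] is multiplicative because antipodes
    reverse products ([antipodeM]), and sends [S^a v] to the generators, because
    both sides arise by the same successive inversions of matrices
    ([to_words_iter_antipode]). So it takes its values in [coef_alg], and is a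
    morphism of models. It is the only one since it is imposed on generators.
    Finally a morphism onto a left-faithful model is surjective, and one from a
    right-faithful model is injective, which gives the uniqueness of the
    bi-faithful model. *)

(** * Tensors and functionals *)

Section LinearPredicate.
Variables (k : fieldType) (U C : lmodType k) (f : U -> C).
Hypothesis fL : linear f.

Lemma lin0 : f 0 = 0. Proof. by rewrite (linear_scale0 fL). Qed.
Lemma linZ c x : f (c *: x) = c *: f x.
Proof. by rewrite (linear_scale0 fL). Qed.
Lemma linD x y : f (x + y) = f x + f y.
Proof. by rewrite (linear_scale0 fL). Qed.
Lemma lin_sum (I : Type) (r : seq I) (P : pred I) (F : I -> U) :
  f (\sum_(i <- r | P i) F i) = \sum_(i <- r | P i) f (F i).
Proof. exact: (big_morph f linD lin0). Qed.

End LinearPredicate.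

Section TensorFacts.
Variable k : fieldType.

Lemma id_linear (U : lmodType k) : linear (@idfun U).
Proof. by []. Qed.

Lemma mul_functionals_bilinear (A B : lmodType k)
    (f : A -> k^o) (g : B -> k^o) :
  linear f -> linear g -> bilinear_map (fun a b => f a * g b : k^o).
Proof.
move=> fL gL; split=> [a|b] c x y.
  by rewrite gL mulrDr; congr (_ + _); apply: mulrCA.
by rewrite /= fL mulrDl -scalerAl.
Qed.

Lemma linear_tlift (A B C D : lmodType k) (F : A -> B -> C) (g : C -> D) t :
  linear g -> g (tlift F t) = tlift (fun a b => g (F a b)) t.
Proof. by move=> gL; rewrite /tlift /eval_sum lin_sum. Qed.

Lemma tlift_tmap (A B A' B' C : lmodType k) (f : A -> A') (g : B -> B')
    (F : A' -> B' -> C) t :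
  linear f -> linear g -> bilinear_map F ->
  tlift F (tmap f g t) = tlift (fun a b => F (f a) (g b)) t.
Proof.
move=> fL gL FB; have FL := tlift_linear FB.
rewrite /tmap linear_tlift // /tlift /eval_sum; apply: eq_bigr => p _.
exact: tlift_pure.
Qed.

Lemma eq_tlift (A B C : lmodType k) (F G : A -> B -> C) t :
  (forall a b, F a b = G a b) -> tlift F t = tlift G t.
Proof. by move=> FG; rewrite /tlift /eval_sum; apply: eq_bigr. Qed.

Lemma tlift_tmul (A B : algType k) (C : lmodType k) (F : A -> B -> C)
    (t t' : tensor A B) : bilinear_map F ->
  tlift F (tmul *%R *%R t t') =
  \sum_(p <- repr t) \sum_(q <- repr t') F (p.1 * q.1) (p.2 * q.2).
Proof.
move=> FB; have [tL tR] := tmul_bilinear (@mulr_bilinear k A) (@mulr_bilinear k B).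
have FL := tlift_linear FB.
rewrite {1}[t]tensor_sum_pure (lin_sum (tR _)) (lin_sum FL); apply: eq_bigr => p _.
rewrite {1}[t']tensor_sum_pure (lin_sum (tL _)) (lin_sum FL); apply: eq_bigr => q _.
rewrite tmul_pure ?tlift_pure //; exact: mulr_bilinear.
Qed.

(** If the first entry [a] of a formal sum [a (x) b + ...] does not vanish, then
    some functional [e i] does not vanish at it; since the pairing with
    [e i (x) _] is zero, [b] is a combination of the other second entries, and
    the sum can be rewritten with one term less. *)
Lemma tensor_separated (A B : lmodType k) (I J : Type)
    (e : I -> A -> k^o) (e' : J -> B -> k^o)
    (eL : forall i, linear (e i)) (eL' : forall j, linear (e' j)) :
  (forall a, (forall i, e i a = 0) -> a = 0) ->
  (forall b, (forall j, e' j b = 0) -> b = 0) ->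
  forall t t' : tensor A B,
  (forall i j, tlift (fun a b => e i a * e' j b : k^o) t =
               tlift (fun a b => e i a * e' j b : k^o) t') -> t = t'.
Proof.
move=> sepA sepB t t' tt'; apply/subr0_eq.
pose F i j a b : k^o := e i a * e' j b.
have FB i j : bilinear_map (F i j) by apply: mul_functionals_bilinear.
have {tt'} : forall i j, tlift (F i j) (t - t') = 0.
  by move=> i j; rewrite addrC -scaleN1r (tlift_linear (FB i j)) tt' scaleN1r addNr.
move: (t - t') => {t'}t; rewrite [t]tensor_sum_pure => t0.
have {}t0 : forall i j, \sum_(p <- repr t) F i j p.1 p.2 = 0.
  move=> i j; rewrite -[RHS](t0 i j) (lin_sum (tlift_linear (FB i j))).
  by apply: eq_bigr => p _; rewrite tlift_pure.
have [pureL pureR] := pure_bilinear A B.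
move: {t}(repr t : seq _) t0 => s.
elim: {s}(size s) {-2}s (leqnn (size s)) => [|n IHn] [|[a b] s] //= sz_s t0;
  rewrite ?big_nil // big_cons /=.
have [a0|/eqP a0] := eqVneq a 0.
  rewrite a0 (lin0 (pureR b)) add0r IHn // => i j.
  by have := t0 i j; rewrite big_cons /= /F a0 (lin0 (eL i)) mul0r add0r.
have [i ei] : exists i, e i a != 0.
  apply: contrapT => /forallNP h; apply: a0; apply: sepA => i.
  by have /negP := h i; rewrite negbK => /eqP.
pose c (q : A * B) : k := - (e i q.1 / e i a).
have Eb : b = \sum_(q <- s) c q *: q.2.
  apply/subr0_eq/sepB => j; have := t0 i j; rewrite big_cons /= /F => h.
  apply: (mulfI ei); rewrite mulr0 addrC -scaleN1r (eL' j) (lin_sum (eL' j)).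
  rewrite scaleN1r mulrDr -[RHS]h [RHS]addrC; congr (_ + _).
  rewrite mulrN mulr_sumr -sumrN; apply: eq_bigr => q _.
  rewrite (linZ (eL' j)) /c -[_ *: _]/(_ * _).
  by rewrite mulNr mulrN opprK mulrA mulrCA divff ?mulr1.
pose s' := [seq (c q *: a + q.1, q.2) | q <- s].
have -> : pure a b + \sum_(q <- s) pure q.1 q.2 = \sum_(q <- s') pure q.1 q.2.
  rewrite {1}Eb (lin_sum (pureL a)) -big_split big_map; apply: eq_bigr => q _ /=.
  by rewrite (linZ (pureL a)) (pureR q.2).
apply: IHn => [|i' j]; first by rewrite size_map.
rewrite big_map -[RHS](t0 i' j) big_cons {2}Eb.
have [FL FR] := FB i' j; rewrite (lin_sum (FL a)) -big_split.
by apply: eq_bigr => q _; rewrite (linZ (FL a)) (FR q.2).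
Qed.

End TensorFacts.

(** * Matrix coordinates of endomorphisms *)

Section Coordinates.
Variables (k : fieldType) (V : vectType k).
Local Notation n := (dim V).

(** Columns index the source, so that composition becomes the product of
    matrices; [f2mx], which acts on rows, reverses it. *)
Definition emx (T : 'End(V)) : 'M[k]_n :=
  \matrix_(i < n, j < n) v2r (T (r2v (delta_mx 0 j))) 0 i.
Definition mxe (A : 'M[k]_n) : 'End(V) :=
  linfun (r2v \o mulmxr A^T \o v2r).

Lemma emx_app (T : 'End(V)) x : v2r (T x) = v2r x *m (emx T)^T.
Proof.
apply/rowP => i; rewrite -{1}[x]v2rK [X in r2v X]row_sum_delta !linear_sum /=.
rewrite !mxE summxE; apply: eq_bigr => j _.
by rewrite !linearZ /= !mxE.
Qed.

Lemma mxeE (A : 'M[k]_n) x : v2r (mxe A x) = v2r x *m A^T.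
Proof. by rewrite lfunE /= r2vK. Qed.

Lemma mxeK : cancel mxe emx.
Proof.
move=> A; apply/matrixP => i j; rewrite mxE mxeE r2vK -rowE !mxE //.
Qed.

Lemma emxK : cancel emx mxe.
Proof. by move=> T; apply/lfunP => x; apply: (can_inj v2rK); rewrite mxeE emx_app. Qed.

Lemma emx_linear : linear emx.
Proof.
move=> c f g; apply/matrixP => i j.
by rewrite !mxE add_lfunE scale_lfunE linearP !mxE.
Qed.

Lemma emx_comp f g : emx (f \o g)%VF = emx f *m emx g.
Proof.
apply: (canLR mxeK); apply/lfunP => x; apply: (can_inj v2rK).
by rewrite mxeE comp_lfunE !emx_app trmx_mul mulmxA.
Qed.

Lemma emx1 : emx \1%VF = 1%:M.
Proof. by apply/matrixP => i j; rewrite !mxE id_lfunE r2vK !mxE eq_sym. Qed.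

Definition eunit i j : 'End(V) := mxe (delta_mx i j).

Lemma emx_eunit i j i' j' : emx (eunit i j) i' j' = ((i' == i) && (j' == j))%:R.
Proof. by rewrite mxeK mxE. Qed.

Lemma emx_sum T : T = \sum_i \sum_j emx T i j *: eunit i j.
Proof.
rewrite -[LHS]emxK [emx T in LHS]matrix_sum_delta.
apply: (can_inj emxK); rewrite mxeK (lin_sum emx_linear); apply: eq_bigr => i _.
rewrite (lin_sum emx_linear); apply: eq_bigr => j _.
by rewrite (linZ emx_linear) mxeK.
Qed.

Section Tmx.
Variable A : lmodType k.

(** This identifies [End(V) (x) A] with the square matrices over [A] ([tmx_sum],
    [tmx_inj]), and its product with theirs ([tmx_tmul]). *)
Definition tmx (t : tensor 'End(V) A) (i j : 'I_n) : A :=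
  tlift (fun T a => emx T i j *: a) t.

Fact emx_scale_bilinear i j :
  bilinear_map (fun (T : 'End(V)) (a : A) => emx T i j *: a).
Proof.
split=> [T|a] c x y; first by rewrite scalerDr !scalerA [_ * c]mulrC.
by rewrite /= emx_linear !mxE scalerDl scalerA.
Qed.

Lemma tmx_linear i j : linear (fun t => tmx t i j).
Proof. exact/tlift_linear/emx_scale_bilinear. Qed.

Lemma tmx_pure T a i j : tmx (pure T a) i j = emx T i j *: a.
Proof. exact/tlift_pure/emx_scale_bilinear. Qed.

Lemma tmx_sum t : t = \sum_i \sum_j pure (eunit i j) (tmx t i j).
Proof.
have [pureL pureR] := pure_bilinear 'End(V) A.
have sumL : linear (fun t => \sum_i \sum_j pure (eunit i j) (tmx t i j)).
  move=> c x y; rewrite scaler_sumr -big_split; apply: eq_bigr => i _.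
  rewrite scaler_sumr -big_split; apply: eq_bigr => j _.
  by rewrite /= (tmx_linear i j) pureL.
apply: (tensor_linear_eq (@id_linear _ _) sumL) t => T a /=.
rewrite [T in LHS]emx_sum (lin_sum (pureR a)); apply: eq_bigr => i _.
rewrite (lin_sum (pureR a)); apply: eq_bigr => j _.
by rewrite tmx_pure (linZ (pureR a)) (linZ (pureL _)).
Qed.

Lemma tmx_inj t t' : (forall i j, tmx t i j = tmx t' i j) -> t = t'.
Proof.
move=> tt'; rewrite [t]tmx_sum [t']tmx_sum.
by apply: eq_bigr => i _; apply: eq_bigr => j _; rewrite tt'.
Qed.

Lemma tmx_of_sum (X : 'I_n -> 'I_n -> A) i j :
  tmx (\sum_i \sum_j pure (eunit i j) (X i j)) i j = X i j.
Proof.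
rewrite (lin_sum (tmx_linear i j)) (bigD1 i) //= (lin_sum (tmx_linear i j)).
rewrite (bigD1 j) //= tmx_pure emx_eunit !eqxx scale1r !big1 ?addr0 //.
  move=> i' ii'; rewrite (lin_sum (tmx_linear i j)) big1 // => j' _.
  by rewrite tmx_pure emx_eunit eq_sym (negPf ii') scale0r.
by move=> j' jj'; rewrite tmx_pure emx_eunit [j == _]eq_sym (negPf jj') andbF scale0r.
Qed.

Lemma tlift_tmx (C : lmodType k) (F : 'End(V) -> A -> C) t : bilinear_map F ->
  tlift F t = \sum_i \sum_j F (eunit i j) (tmx t i j).
Proof.
move=> FB; rewrite [t in LHS]tmx_sum (lin_sum (tlift_linear FB)).
apply: eq_bigr => i _; rewrite (lin_sum (tlift_linear FB)).
by apply: eq_bigr => j _; rewrite tlift_pure.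
Qed.

Lemma tmx_tmul (m : A -> A -> A) t t' i j : bilinear_map m ->
  tmx (tmul (@comp_lfun _ V V V) m t t') i j =
  \sum_l m (tmx t i l) (tmx t' l j).
Proof.
move=> mB; have [mL mR] := mB.
have [tmulL tmulR] := tmul_bilinear (comp_lfun_bilinear V) mB.
apply: (tensor_linear_eq (f := fun t => tmx (tmul _ m t t') i j)
  (g := fun t => \sum_l m (tmx t i l) (tmx t' l j))) t => [c x y|c x y|T a].
- by rewrite tmulR tmx_linear.
- rewrite scaler_sumr -big_split; apply: eq_bigr => l _.
  by rewrite (tmx_linear i l) (mR (tmx t' l j)).
apply: (tensor_linear_eq (f := fun t' => tmx (tmul _ m (pure T a) t') i j)
  (g := fun t' => \sum_l m (tmx (pure T a) i l) (tmx t' l j))) t' =>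
  [c x y|c x y|T' a'].
- by rewrite tmulL tmx_linear.
- rewrite scaler_sumr -big_split; apply: eq_bigr => l _.
  by rewrite (tmx_linear l j) (mL (tmx (pure T a) i l)).
rewrite tmul_pure //; last exact: comp_lfun_bilinear.
rewrite tmx_pure emx_comp mxE scaler_suml; apply: eq_bigr => l _.
by rewrite !tmx_pure (linZ (mR _)) (linZ (mL _)) scalerA.
Qed.

End Tmx.

Lemma tmx_tmap (A B : lmodType k) (f : A -> B) t i j : linear f ->
  tmx (tmap idfun f t) i j = f (tmx t i j).
Proof.
move=> fL; rewrite /tmx tlift_tmap //; last exact: emx_scale_bilinear.
by rewrite (linear_tlift _ _ fL); apply: eq_tlift => T a; rewrite (linZ fL).
Qed.

End Coordinates.

(** * Functions on words *)

(** The letter [(false, p, q)] stands for the entry [(p, q)] of a generic matrix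
    [y], and [(true, p, q)] for the entry [(q, p)] of [S y]: with this
    transposition both kinds of letters have the same coproduct. *)
Definition letter (m : nat) : Type := (bool * 'I_m * 'I_m)%type.

Definition wfun (k : fieldType) (m : nat) : Type := seq (letter m) -> k^o.
HB.instance Definition _ (k : fieldType) (m : nat) :=
  GRing.Lmodule.copy (wfun k m) (seq (letter m) -> k^o).

Section WordFunctions.
Variables (k : fieldType) (m : nat).
Local Notation L := (letter m).
Local Notation P := (wfun k m).
Implicit Types (a b c : P) (w : seq L) (l : L).

Lemma wfunZ (x : k) a w : (x *: a) w = x * a w. Proof. by []. Qed.
Lemma wfun_linear w : linear (fun a => a w : k^o). Proof. by []. Qed.
Lemma wfun_sum I (r : seq I) (Q : pred I) (F : I -> P) w :
  (\sum_(i <- r | Q i) F i) w = \sum_(i <- r | Q i) F i w.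
Proof. exact: (lin_sum (wfun_linear w)). Qed.

Definition shift l a : P := fun z => a (l :: z).

Lemma shift_linear l : linear (shift l). Proof. by []. Qed.

(** Functions on words are linear forms on the free algebra on the letters, and
    this product is dual to its coproduct, which on letters is
    [(e, p, q) |-> \sum_r (e, p, r) (x) (e, r, q)]. *)
Fixpoint wmul a b w : k^o :=
  if w is (e, p, q) :: w' then
    \sum_r wmul (shift (e, p, r) a) (shift (e, r, q) b) w'
  else a [::] * b [::].

Definition wone : P := fun w => (all (fun l => l.1.2 == l.2) w)%:R.

Lemma shift_wmul e p q a b : shift (e, p, q) (wmul a b) =
  \sum_r wmul (shift (e, p, r) a) (shift (e, r, q) b).
Proof. by apply: funext => w; rewrite wfun_sum. Qed.

Lemma shift_wone e p q : shift (e, p, q) wone = (p == q)%:R *: wone.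
Proof.
apply: funext => w; rewrite wfunZ /shift /wone /=.
by case: (p == q); rewrite ?mul1r ?mul0r.
Qed.

Lemma wmul_bilinear : bilinear_map (wmul : P -> P -> P).
Proof.
suff h w (x : k) a a' b : (wmul b (x *: a + a') w =
    x * wmul b a w + wmul b a' w) * (wmul (x *: a + a') b w =
    x * wmul a b w + wmul a' b w).
  by split=> [b|b] x a a'; apply: funext => w; rewrite /= !h.
elim: w a a' b => [|[[e p] q] w IHw] a a' b /=.
  by split; [rewrite mulrDr mulrCA|rewrite mulrDl mulrA].
split; rewrite mulr_sumr -big_split; apply: eq_bigr => r _ /=;
  by rewrite (shift_linear _ x a a') IHw.
Qed.

Let wmulL := wmul_bilinear.1.
Let wmulR := wmul_bilinear.2.

Fact wmulA : associative (wmul : P -> P -> P).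
Proof.
move=> a b c; apply: funext => w.
elim: w a b c => [|[[e p] q] w IHw] a b c /=; first exact: mulrA.
under eq_bigr => r _ do rewrite shift_wmul (lin_sum (wmulL _)) wfun_sum.
under [RHS]eq_bigr => r _ do rewrite shift_wmul (lin_sum (wmulR _)) wfun_sum.
rewrite exchange_big; apply: eq_bigr => r _; apply: eq_bigr => s _.
exact: IHw.
Qed.

Fact wmul1l : left_id wone wmul.
Proof.
move=> a; apply: funext => w.
elim: w a => [|[[e p] q] w IHw] a /=; first by rewrite mul1r.
rewrite (bigD1 p) //= shift_wone eqxx scale1r IHw big1 ?addr0 // => r rp.
by rewrite shift_wone eq_sym (negPf rp) scale0r (lin0 (wmulR _)).
Qed.

Fact wmul1r : right_id wone wmul.
Proof.
move=> a; apply: funext => w.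
elim: w a => [|[[e p] q] w IHw] a /=; first by rewrite mulr1.
rewrite (bigD1 q) //= shift_wone eqxx scale1r IHw big1 ?addr0 // => r rp.
by rewrite shift_wone (negPf rp) scale0r (lin0 (wmulL _)).
Qed.

Fact wmulDl : left_distributive (wmul : P -> P -> P) +%R.
Proof. by move=> a b c; apply: (linD (wmulR c)). Qed.

Fact wmulDr : right_distributive (wmul : P -> P -> P) +%R.
Proof. by move=> a b c; apply: (linD (wmulL a)). Qed.

Fact wone_neq0 : wone != 0 :> P.
Proof.
apply/eqP => /(congr1 (fun a : P => a [::])) /eqP.
by rewrite /wone /= (oner_eq0 k).
Qed.

HB.instance Definition _ := GRing.Zmodule_isNzRing.Build P
  wmulA wmul1l wmul1r wmulDl wmulDr wone_neq0.

Fact wfun_scaleAl (x : k) a b : x *: (a * b) = (x *: a) * b.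
Proof. exact: esym (linZ (wmulR b) x a). Qed.
Fact wfun_scaleAr (x : k) a b : x *: (a * b) = a * (x *: b).
Proof. exact: esym (linZ (wmulL a) x b). Qed.
HB.instance Definition _ := GRing.Lmodule_isLalgebra.Build k P wfun_scaleAl.
HB.instance Definition _ := GRing.Lalgebra_isAlgebra.Build k P wfun_scaleAr.

Lemma wmul_nil a b : (a * b) [::] = a [::] * b [::]. Proof. by []. Qed.
Lemma wmul_cons a b e p q w : (a * b) ((e, p, q) :: w) =
  \sum_r (shift (e, p, r) a * shift (e, r, q) b) w.
Proof. by []. Qed.
Lemma wone_nil : (1 : P) [::] = 1. Proof. by []. Qed.
Lemma wone_cons e p q w : (1 : P) ((e, p, q) :: w) = (p == q)%:R * (1 : P) w.
Proof. by rewrite -[LHS]/(shift (e, p, q) wone w) shift_wone wfunZ. Qed.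

(** The coproduct dual to concatenation is multiplicative. It is stated for
    functions with a given finite expansion, because [wfun] is too large to
    carry this coproduct. *)
Lemma wmul_cat (s s' : seq (P * P)) a a' w w' :
  (forall w w', a (w ++ w') = \sum_(p <- s) p.1 w * p.2 w') ->
  (forall w w', a' (w ++ w') = \sum_(p <- s') p.1 w * p.2 w') ->
  (a * a') (w ++ w') =
  \sum_(p <- s) \sum_(q <- s') (p.1 * q.1) w * (p.2 * q.2) w'.
Proof.
elim: w s s' a a' => [|[[e i] j] w IHw] s s' a a' as_ as'.
  have -> : a = \sum_(p <- s) p.1 [::] *: p.2.
    by apply: funext => z; rewrite (as_ [::]) wfun_sum.
  have -> : a' = \sum_(p <- s') p.1 [::] *: p.2.
    by apply: funext => z; rewrite (as' [::]) wfun_sum.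
  rewrite mulr_suml wfun_sum; apply: eq_bigr => p _.
  rewrite mulr_sumr wfun_sum; apply: eq_bigr => q _.
  by rewrite -scalerAl -scalerAr scalerA.
rewrite wmul_cons.
under eq_bigr => r _.
  pose sh l (p : P * P) := (shift l p.1, p.2).
  rewrite (IHw (map (sh (e, i, r)) s) (map (sh (e, r, j)) s')); first last.
  - by move=> z z'; rewrite /shift -cat_cons as' big_map.
  - by move=> z z'; rewrite /shift -cat_cons as_ big_map.
  rewrite big_map; under eq_bigr => p _ do rewrite big_map.
  over.
rewrite exchange_big; apply: eq_bigr => p _.
rewrite exchange_big; apply: eq_bigr => q _ /=.
by rewrite -mulr_suml wmul_cons.
Qed.

(** * The antipode of functions on words *)

(** The antipode of the generic matrices of [letter]. Exchanging [S y] and [y]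
    makes it an involution: the functions considered below do not distinguish
    [S^2 y] from [y]. *)
Definition flip_letter l : L := (~~ l.1.1, l.2, l.1.2).
Definition flip_word w : seq L := rev (map flip_letter w).
Definition wflip a : P := fun w => a (flip_word w).

Lemma flip_letterK : involutive flip_letter.
Proof. by case=> [[e p] q]; rewrite /flip_letter /= negbK. Qed.

Lemma flip_wordK : involutive flip_word.
Proof. by move=> w; rewrite /flip_word map_rev revK (mapK flip_letterK). Qed.

Lemma wflipK : involutive wflip.
Proof. by move=> a; apply: funext => w; rewrite /wflip flip_wordK. Qed.

Lemma wflip_linear : linear wflip. Proof. by []. Qed.

Lemma flip_word_cons l w : flip_word (l :: w) = rcons (flip_word w) (flip_letter l).
Proof. by rewrite /flip_word map_cons rev_cons. Qed.

Definition shift_last l a : P := fun z => a (rcons z l).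

Lemma wmul_rcons a b e p q w : (a * b) (rcons w (e, p, q)) =
  \sum_r (shift_last (e, p, r) a * shift_last (e, r, q) b) w.
Proof.
elim: w a b => [|[[e' p'] q'] w IHw] a b //.
rewrite rcons_cons wmul_cons; under eq_bigr => r _ do rewrite IHw.
by rewrite exchange_big.
Qed.

(** A word is read from its last letter after the flip, and exchanging [p] and
    [q] exchanges the two factors of the coproduct of a letter. *)
Lemma wflipM a b : wflip (a * b) = wflip b * wflip a.
Proof.
apply: funext => w; rewrite {1}/wflip.
elim: w a b => [|[[e p] q] w IHw] a b; first exact: mulrC.
rewrite flip_word_cons wmul_rcons wmul_cons; apply: eq_bigr => r _.
have flip_shift l c : wflip (shift_last (flip_letter l) c) = shift l (wflip c).
  by apply: funext => z; rewrite /shift /wflip flip_word_cons.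
by rewrite IHw (flip_shift (e, p, r)) (flip_shift (e, r, q)).
Qed.

Lemma wflip1 : wflip 1 = 1.
Proof. by rewrite -[LHS]mulr1 -[X in _ * X]wflipK -wflipM mulr1 wflipK. Qed.

End WordFunctions.

(** * The Hopf algebra of coefficients *)

Section CoefficientAlgebra.
Variables (k : fieldType) (n m : nat) (rho : letter m -> 'M[k]_n).
Local Notation L := (letter m).
Local Notation P := (wfun k m).
Implicit Types (w : seq L) (l : L) (e : bool) (i j : 'I_n).

Definition rho_word w : 'M[k]_n := foldr (fun l A => rho l *m A) 1%:M w.

Lemma rho_word_cat w w' : rho_word (w ++ w') = rho_word w *m rho_word w'.
Proof. by elim: w => [|l w IHw] /=; rewrite ?mul1mx // IHw mulmxA. Qed.

(** For [e] false these are the entries that the matrix [v] is to have, and for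
    [e] true those of its antipode. *)
Definition gen e i j : P :=
  if e then wflip (fun w => rho_word w i j) else fun w => rho_word w i j.

Lemma wflip_gen e i j : wflip (gen e i j) = gen (~~ e) i j.
Proof. by case: e; rewrite //= wflipK. Qed.

Definition gens : set P := [set x | exists e i j, x = gen e i j].
Definition coef_pred : P -> bool := fun x => `[< subalg_gen gens x >].

Fact coef_pred_closed : subalg_closed coef_pred.
Proof.
split=> [|c x y /asboolP gx /asboolP gy|x y /asboolP gx /asboolP gy]; apply/asboolP.
- exact: subalg_gen_one.
- exact/subalg_gen_add/gy/subalg_gen_scale.
- exact: subalg_gen_mul.
Qed.
HB.instance Definition _ :=
  GRing.isSubalgClosed.Build k P coef_pred coef_pred_closed.

Record coef_alg := CoefAlg { coef_val :> P; coef_valP : coef_pred coef_val }.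
HB.instance Definition _ := [isSub of coef_alg for coef_val].
HB.instance Definition _ := [Choice of coef_alg by <:].
HB.instance Definition _ := [SubChoice_isSubAlgebra of coef_alg by <:].

Implicit Types x y z : coef_alg.

Lemma coef_val_linear : linear coef_val. Proof. by []. Qed.
Lemma coef_val_inj : injective coef_val. Proof. exact: val_inj. Qed.
Lemma coef_valZ (c : k) x : c *: x = c *: (x : P) :> P. Proof. by []. Qed.

Fact gen_coef e i j : coef_pred (gen e i j).
Proof. by apply/asboolP/subalg_gen_in; exists e, i, j. Qed.
Definition cgen e i j : coef_alg := CoefAlg (gen_coef e i j).

Lemma coef_ind (Q : coef_alg -> Prop) :
  (forall e i j, Q (cgen e i j)) -> Q 1 ->
  (forall c x y, Q x -> Q y -> Q (c *: x + y)) ->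
  (forall x y, Q x -> Q y -> Q (x * y)) -> forall x, Q x.
Proof.
move=> Qgen Q1 QP QM [x gx]; have /asboolP gx' := gx.
suff: exists2 y : coef_alg, coef_val y = x & Q y.
  by case=> y yx Qy; rewrite (_ : CoefAlg gx = y) //; apply: val_inj.
have Q0 : Q 0 by have := QP (-1) _ _ Q1 Q1; rewrite scaleN1r addNr.
elim: {gx}x / gx' => [x [e [i [j ->]]]||x y _ [x' <- Qx] _ [y' <- Qy]|
    c x _ [x' <- Qx]|x y _ [x' <- Qx] _ [y' <- Qy]].
- by exists (cgen e i j).
- by exists 1.
- by exists (1 *: x' + y'); [rewrite scale1r|exact: QP].
- by exists (c *: x' + 0); [rewrite addr0|exact: QP].
- by exists (x' * y'); last exact: QM.
Qed.

(** ** Counit and coproduct *)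

Definition ccounit x : k^o := (x : P) [::].
HB.instance Definition _ := GRing.isLinear.Build k coef_alg k^o *:%R ccounit
  (fun c x y => erefl).
HB.instance Definition _ := GRing.isMonoidMorphism.Build coef_alg k^o ccounit
  (conj erefl (fun x y => erefl)).

Definition ev x w : k^o := (x : P) w.
Lemma ev_linear w : linear (ev^~ w). Proof. by []. Qed.

Lemma ev_inj x y : (forall w, ev x w = ev y w) -> x = y.
Proof. by move=> xy; apply: val_inj; apply: funext => w; apply: xy. Qed.

Definition ev2 w w' : tensor coef_alg coef_alg -> k^o :=
  tlift (fun x y => ev x w * ev y w' : k^o).

Lemma ev2_bilinear w w' : bilinear_map (fun x y => ev x w * ev y w' : k^o).
Proof. by apply: mul_functionals_bilinear. Qed.

Lemma ev2_linear w w' : linear (ev2 w w').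
Proof. exact/tlift_linear/ev2_bilinear. Qed.

Lemma ev2_pure w w' x y : ev2 w w' (pure x y) = ev x w * ev y w'.
Proof. exact/tlift_pure/ev2_bilinear. Qed.

Lemma ev2_inj t t' : (forall w w', ev2 w w' t = ev2 w w' t') -> t = t'.
Proof.
apply: tensor_separated => // a a0; apply: ev_inj => w; exact: a0.
Qed.

(** Concatenation of words being dual to the coproduct, this is the
    multiplicativity of the latter. *)
Lemma ev2_tmul t t' x y :
  (forall w w', ev2 w w' t = ev x (w ++ w')) ->
  (forall w w', ev2 w w' t' = ev y (w ++ w')) ->
  forall w w', ev2 w w' (tmul *%R *%R t t') = ev (x * y) (w ++ w').
Proof.
move=> tx ty w w'; pose s (t : tensor coef_alg coef_alg) :=
  [seq (coef_val p.1, coef_val p.2) | p <- repr t].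
have sE (u : tensor coef_alg coef_alg) z :
  (forall w w', ev2 w w' u = ev z (w ++ w')) ->
  forall w w', (z : P) (w ++ w') = \sum_(p <- s u) p.1 w * p.2 w'.
  by move=> uz v v'; rewrite big_map -[LHS]uz.
rewrite [RHS](wmul_cat _ _ (sE _ _ tx) (sE _ _ ty)) big_map.
rewrite /ev2 (tlift_tmul _ _ (ev2_bilinear w w')); apply: eq_bigr => p _.
by rewrite big_map.
Qed.

Definition cgen_comul e i j : tensor coef_alg coef_alg :=
  \sum_l if e then pure (cgen e l j) (cgen e i l) else pure (cgen e i l) (cgen e l j).

Lemma ev2_cgen_comul e i j w w' :
  ev2 w w' (cgen_comul e i j) = ev (cgen e i j) (w ++ w').
Proof.
rewrite /cgen_comul (lin_sum (ev2_linear w w')) /ev; case: e => /=.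
  rewrite /wflip /flip_word map_cat rev_cat rho_word_cat mxE.
  by apply: eq_bigr => l _; rewrite ev2_pure mulrC.
by rewrite rho_word_cat mxE; apply: eq_bigr => l _; rewrite ev2_pure.
Qed.

Lemma ev_one_cat w w' : ev 1 (w ++ w') = ev 1 w * ev 1 w'.
Proof.
rewrite /ev /=; elim: w => [|[[e p] q] w IHw]; first by rewrite mul1r.
by rewrite cat_cons !wone_cons IHw mulrA.
Qed.

(** The elements that have a coproduct form a subalgebra. It contains the
    generators, because [rho_word] turns concatenation into the product of
    matrices. *)
Fact comul_exists x : exists t, forall w w', ev2 w w' t = ev x (w ++ w').
Proof.
elim/coef_ind: x => [e i j||c x y [t tx] [t' ty]|x y [t tx] [t' ty]].
- by exists (cgen_comul e i j) => w w'; apply: ev2_cgen_comul.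
- by exists (pure 1 1) => w w'; rewrite ev2_pure ev_one_cat.
- by exists (c *: t + t') => w w'; rewrite (ev2_linear w w') tx ty.
- by exists (tmul *%R *%R t t'); apply: ev2_tmul.
Qed.

Definition ccomul x : tensor coef_alg coef_alg := projT1 (cid (comul_exists x)).

Lemma ev2_comul w w' x : ev2 w w' (ccomul x) = ev x (w ++ w').
Proof. by rewrite /ccomul; case: cid => t /= ->. Qed.

Lemma ccomul_unique x t :
  (forall w w', ev2 w w' t = ev x (w ++ w')) -> ccomul x = t.
Proof. by move=> tx; apply: ev2_inj => w w'; rewrite ev2_comul. Qed.

Fact ccomul_linear : linear ccomul.
Proof.
move=> c x y; apply: ccomul_unique => w w'.
by rewrite (ev2_linear w w') !ev2_comul.
Qed.
HB.instance Definition _ := GRing.isLinear.Build k coef_alg _ *:%R ccomul ccomul_linear.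

Fact ccomul1 : ccomul 1 = pure 1 1.
Proof. by apply: ccomul_unique => w w'; rewrite ev2_pure ev_one_cat. Qed.

Fact ccomulM x y : ccomul (x * y) = tmul *%R *%R (ccomul x) (ccomul y).
Proof. by apply/ccomul_unique/ev2_tmul => w w'; apply: ev2_comul. Qed.

Lemma ccomul_cgen e i j : ccomul (cgen e i j) = cgen_comul e i j.
Proof. by apply: ccomul_unique => w w'; apply: ev2_cgen_comul. Qed.

Fact ccounitl x : tlift (fun y z => ccounit y *: z) (ccomul x) = x.
Proof.
apply: ev_inj => w; rewrite (linear_tlift _ _ (ev_linear w)).
rewrite -[RHS]/(ev x ([::] ++ w)) -ev2_comul.
exact: eq_tlift.
Qed.

Fact ccounitr x : tlift (fun y z => ccounit z *: y) (ccomul x) = x.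
Proof.
apply: ev_inj => w; rewrite (linear_tlift _ _ (ev_linear w)) -{2}[w]cats0 -ev2_comul.
by apply: eq_tlift => y z; rewrite /ev [RHS]mulrC.
Qed.

(** Evaluated at three words [w], [w'] and [w''], both sides are the value of
    [x] at their concatenation. *)
Fact ccomulA x : tassoc (tmap ccomul idfun (ccomul x)) = tmap idfun ccomul (ccomul x).
Proof.
pose T3 w (p : seq L * seq L) (t : tensor coef_alg (tensor coef_alg coef_alg)) :=
  tlift (fun x t => ev x w * ev2 p.1 p.2 t : k^o) t.
have T3B w p : bilinear_map (fun x t => ev x w * ev2 p.1 p.2 t : k^o).
  apply: mul_functionals_bilinear; [exact: ev_linear|exact: ev2_linear].
have assocL : linear (@tassoc k coef_alg coef_alg coef_alg).
  exact/tlift_linear/tassoc_bilinear.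
have T3L w p : linear (T3 w p) by apply/tlift_linear/T3B.
apply: (@tensor_separated _ _ _ (seq L) (seq L * seq L) (fun w x => ev x w)
  (fun p t => ev2 p.1 p.2 t)) => //.
- by move=> [w w']; apply: ev2_linear.
- by move=> a a0; apply: ev_inj => v; apply: a0.
- move=> t t0; apply: ev2_inj => w w'.
  by have := t0 (w, w'); rewrite (lin0 (ev2_linear w w')).
move=> w [w' w'']; rewrite -!/(T3 w (w', w'') _).
have -> : T3 w (w', w'') (tmap idfun ccomul (ccomul x)) = ev x (w ++ w' ++ w'').
  rewrite /T3 tlift_tmap //; last exact: ccomul_linear.
  by rewrite -ev2_comul; apply: eq_tlift => y z; rewrite ev2_comul.
have [pL pR] := pure_bilinear (tensor coef_alg coef_alg) coef_alg.
rewrite catA -ev2_comul /tmap (linear_tlift _ _ assocL) (linear_tlift _ _ (T3L _ _)).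
apply: eq_tlift => y z /=.
rewrite -ev2_comul; move: (ccomul y); apply: tensor_linear_eq => [c t t'|c t t'|a b].
- by rewrite pR assocL T3L.
- by rewrite (ev2_linear w w') mulrDl -scalerAl.
by rewrite tassoc_pure /T3 tlift_pure // !ev2_pure mulrA.
Qed.

(** ** Antipode *)

Fact wflip_coef x : coef_pred (wflip x).
Proof.
elim/coef_ind: x => [e i j||c x y gx gy|x y gx gy].
- by rewrite wflip_gen gen_coef.
- by rewrite wflip1; apply: rpred1.
- by rewrite /= wflip_linear; apply: rpredD => //; apply: rpredZ.
- by rewrite /= wflipM; apply: rpredM.
Qed.
Definition cantipode x : coef_alg := CoefAlg (wflip_coef x).

Fact cantipode_linear : linear cantipode.
Proof. by move=> c x y; apply: val_inj. Qed.
HB.instance Definition _ :=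
  GRing.isLinear.Build k coef_alg coef_alg *:%R cantipode cantipode_linear.

Lemma cantipodeM x y : cantipode (x * y) = cantipode y * cantipode x.
Proof. by apply: val_inj; apply: wflipM. Qed.
Lemma cantipode1 : cantipode 1 = 1.
Proof. by apply: val_inj; apply: wflip1. Qed.
Lemma cantipode_cgen e i j : cantipode (cgen e i j) = cgen (~~ e) i j.
Proof. by apply: val_inj; apply: wflip_gen. Qed.

End CoefficientAlgebra.

(** If [rho (false, p, q)] collects the entries of some [u], and
    [rho (true, q, p)] those of some [u'], the instances at [false] say that [u']
    is inverse to [u], and the instances at [true] that the transposes of [u']
    and [u] on one leg are inverse to each other. *)
Definition flip_inverse (k : fieldType) (n m : nat) (rho : letter m -> 'M[k]_n) :=
  (forall e p q, \sum_r rho (~~ e, r, p) *m rho (e, r, q) = ((p == q)%:R)%:M) /\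
  (forall e p q, \sum_r rho (e, p, r) *m rho (~~ e, q, r) = ((p == q)%:R)%:M).

Section CoefficientHopf.
Variables (k : fieldType) (n m : nat) (rho : letter m -> 'M[k]_n).
Hypothesis rhoP : flip_inverse rho.
Local Notation P := (wfun k m).
Local Notation gen := (gen rho).


Definition genmx e : 'M[P]_n := \matrix_(i, j) gen e i j.

Definition scmx (A : 'M[k]_n) : 'M[P]_n := map_mx (fun x => x *: 1) A.
Definition evmx w (M : 'M[P]_n) : 'M[k]_n := map_mx (fun a => a w) M.

Lemma evmx_sum I (r : seq I) (F : I -> 'M[P]_n) w :
  evmx w (\sum_(i <- r) F i) = \sum_(i <- r) evmx w (F i).
Proof.
apply/matrixP => i j; rewrite mxE !summxE wfun_sum.
by apply: eq_bigr => s _; rewrite mxE.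
Qed.

Lemma evmx_mul_scmx w A M : evmx w (scmx A *m M) = A *m evmx w M.
Proof.
apply/matrixP => i j; rewrite !mxE wfun_sum; apply: eq_bigr => s _.
by rewrite !mxE -scalerAl mul1r.
Qed.

Lemma evmx_scmx_mul w A M : evmx w (M *m scmx A) = evmx w M *m A.
Proof.
apply/matrixP => i j; rewrite !mxE wfun_sum; apply: eq_bigr => s _.
by rewrite !mxE -scalerAr mulr1 wfunZ mulrC.
Qed.

Lemma scmx_mul A B : scmx (A *m B) = scmx A *m scmx B.
Proof.
apply/matrixP => i j; rewrite !mxE scaler_suml; apply: eq_bigr => s _.
by rewrite !mxE -scalerAl mul1r scalerA.
Qed.

Lemma scmx_sum I (r : seq I) (F : I -> 'M[k]_n) :
  scmx (\sum_(i <- r) F i) = \sum_(i <- r) scmx (F i).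
Proof.
apply/matrixP => i j; rewrite mxE !summxE scaler_suml.
by apply: eq_bigr => s _; rewrite mxE.
Qed.

Lemma scmx_scalar c : scmx c%:M = (c *: 1)%:M.
Proof.
by apply/matrixP => i j; rewrite !mxE; case: (i == j); rewrite ?mulr1n ?mulr0n ?scale0r.
Qed.

Lemma scalar_mx0 (R : pzRingType) : (0 : R)%:M = 0 :> 'M_n.
Proof. exact: raddf0. Qed.

Lemma scmx0 : scmx 0 = 0.
Proof. by apply/matrixP => i j; rewrite !mxE scale0r. Qed.

Lemma evmx0 w : evmx w 0 = 0.
Proof. by apply/matrixP => i j; rewrite !mxE. Qed.

Lemma evmx_cons_mul e p q w (M N : 'M[P]_n) : evmx ((e, p, q) :: w) (M *m N) =
  \sum_r evmx w (map_mx (shift (e, p, r)) M *m map_mx (shift (e, r, q)) N).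
Proof.
apply/matrixP => i j; rewrite summxE !mxE wfun_sum.
under eq_bigr => s _ do rewrite wmul_cons.
rewrite exchange_big; apply: eq_bigr => r _.
by rewrite !mxE wfun_sum; apply: eq_bigr => s _; rewrite !mxE.
Qed.

Lemma shift_genmx l : map_mx (shift l) (genmx false) = scmx (rho l) *m genmx false.
Proof.
apply/matrixP => i j; rewrite !mxE; apply: funext => w.
rewrite wfun_sum [LHS]mxE; apply: eq_bigr => s _.
by rewrite !mxE -scalerAl mul1r.
Qed.

Lemma shift_genmx_flip l :
  map_mx (shift l) (genmx true) = genmx true *m scmx (rho (flip_letter l)).
Proof.
apply/matrixP => i j; rewrite !mxE; apply: funext => w.
rewrite /shift wfun_sum /= /wflip flip_word_cons -cats1 rho_word_cat /= mulmx1 mxE.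
by apply: eq_bigr => s _; rewrite !mxE -scalerAr mulr1 wfunZ mulrC.
Qed.

Lemma evmx_nil_genmx e : evmx [::] (genmx e) = 1%:M.
Proof. by apply/matrixP => i j; rewrite !mxE; case: e; rewrite /= /wflip /= mxE. Qed.

Lemma evmx_nil_mul M N : evmx [::] (M *m N) = evmx [::] M *m evmx [::] N.
Proof.
apply/matrixP => i j; rewrite !mxE wfun_sum; apply: eq_bigr => s _.
by rewrite !mxE.
Qed.

Lemma evmx_eq1 M : (forall w, evmx w M = ((1 : P) w)%:M) -> M = 1%:M.
Proof.
move=> M1; apply/matrixP => i j; apply: funext => w.
have := congr1 (fun A : 'M_n => A i j) (M1 w); rewrite !mxE => ->.
by case: (i == j).
Qed.

(** Reading a letter [(e, p, q)] inserts, between the two factors, the matrix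
    [\sum_r rho (~~ e, r, p) *m rho (e, r, q)], which is scalar. *)
Lemma genmx_flip_mul : genmx true *m genmx false = 1%:M.
Proof.
apply: evmx_eq1; elim=> [|[[e p] q] w IHw].
  by rewrite evmx_nil_mul !evmx_nil_genmx mulmx1 wone_nil.
rewrite evmx_cons_mul.
under eq_bigr => r _.
  rewrite shift_genmx shift_genmx_flip mulmxA -(mulmxA (genmx true)) -scmx_mul.
  over.
rewrite -evmx_sum -mulmx_suml -mulmx_sumr -scmx_sum (rhoP.1 e p q) wone_cons.
case: (p == q) => /=; rewrite ?mulr1n ?mulr0n.
  by rewrite mul1r scmx_scalar scale1r mulmx1.
by rewrite !scalar_mx0 scmx0 mulmx0 mul0mx evmx0 mul0r scalar_mx0.
Qed.

(** Here the product for the shorter word stands between [rho (e, p, r)] and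
    [rho (~~ e, q, r)]; once it is known to be scalar, these two cancel. *)
Lemma genmx_mul_flip : genmx false *m genmx true = 1%:M.
Proof.
apply: evmx_eq1; elim=> [|[[e p] q] w IHw].
  by rewrite evmx_nil_mul !evmx_nil_genmx mulmx1 wone_nil.
rewrite evmx_cons_mul wone_cons.
under eq_bigr => r _.
  rewrite shift_genmx shift_genmx_flip mulmxA -(mulmxA (scmx _)).
  rewrite evmx_scmx_mul evmx_mul_scmx IHw mul_mx_scalar -scalemxAl.
  over.
by rewrite -scaler_sumr (rhoP.2 e p q) scale_scalar_mx mulrC.
Qed.


(** ** Hopf structure *)

Local Notation C := (coef_alg rho).

Lemma genmx_mulE (e : bool) i j :
  \sum_l cgen rho (~~ e) i l * cgen rho e l j = (i == j)%:R *: 1.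
Proof.
apply: coef_val_inj; rewrite (lin_sum (@coef_val_linear _ _ _ rho)) coef_valZ.
have /matrixP /(_ i j) : genmx (~~ e) *m genmx e = 1%:M.
  by case: e; [exact: genmx_mul_flip|exact: genmx_flip_mul].
rewrite !mxE => h.
transitivity (\sum_l genmx (~~ e) i l * genmx e l j).
  by apply: eq_bigr => l _; rewrite !mxE.
by rewrite h; case: (i == j); rewrite ?scale1r ?scale0r.
Qed.

(** The antipode reverses products, which turns the two inversion formulas
    into the ones for the transposed matrices. *)
Lemma genmx_mul_trE (e : bool) i j :
  \sum_l cgen rho (~~ e) l j * cgen rho e i l = (i == j)%:R *: 1.
Proof.
have := congr1 (@cantipode _ _ _ rho) (genmx_mulE e i j).
rewrite (lin_sum (@cantipode_linear _ _ _ rho)) (linZ (@cantipode_linear _ _ _ rho)).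
rewrite cantipode1 => <-; apply: eq_bigr => l _.
by rewrite cantipodeM !cantipode_cgen negbK.
Qed.

Let SmulB : bilinear_map (fun x y : C => cantipode x * y).
Proof.
have [mL mR] := @mulr_bilinear _ C.
by split=> [x|y] c a b; [apply: mL|rewrite /= cantipode_linear; apply: mR].
Qed.

Let mulSB : bilinear_map (fun x y : C => x * cantipode y).
Proof.
have [mL mR] := @mulr_bilinear _ C.
by split=> [x|y] c a b; [rewrite cantipode_linear; apply: mL|apply: mR].
Qed.

Lemma ccounit_cgen e i j : ccounit (cgen rho e i j) = (i == j)%:R.
Proof. by case: e; rewrite /ccounit /= /wflip /= mxE. Qed.

(** On products [x * y] the law for [x] applies inside the one for [y], since
    the antipode reverses products. *)
Fact cantipodel (x : C) :
  tlift (fun y z => cantipode y * z) (ccomul x) = (ccounit x : k) *: 1.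
Proof.
elim/coef_ind: x => [e i j||c x y Sx Sy|x y Sx Sy].
- rewrite ccomul_cgen ccounit_cgen (lin_sum (tlift_linear SmulB)).
  case: e; [rewrite -(genmx_mul_trE true)|rewrite -(genmx_mulE false)];
    by apply: eq_bigr => l _; rewrite tlift_pure // cantipode_cgen.
- by rewrite ccomul1 tlift_pure // cantipode1 mulr1 rmorph1 scale1r.
- by rewrite !linearP (tlift_linear SmulB) Sx Sy scalerDl scalerA.
rewrite ccomulM tlift_tmul // exchange_big.
transitivity ((ccounit x : k) *: ((ccounit y : k) *: (1 : C))); last first.
  by rewrite scalerA rmorphM.
rewrite -Sy [in RHS]/tlift /eval_sum scaler_sumr; apply: eq_bigr => q _.
rewrite -[in RHS](mul1r q.2) scalerAr scalerAl -Sx.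
rewrite mulr_suml mulr_sumr; apply: eq_bigr => p _.
by rewrite cantipodeM !mulrA.
Qed.

Fact cantipoder (x : C) :
  tlift (fun y z => y * cantipode z) (ccomul x) = (ccounit x : k) *: 1.
Proof.
elim/coef_ind: x => [e i j||c x y Sx Sy|x y Sx Sy].
- rewrite ccomul_cgen ccounit_cgen (lin_sum (tlift_linear mulSB)).
  case: e; [rewrite -(genmx_mul_trE false)|rewrite -(genmx_mulE true)];
    by apply: eq_bigr => l _; rewrite tlift_pure // cantipode_cgen.
- by rewrite ccomul1 tlift_pure // cantipode1 mulr1 rmorph1 scale1r.
- by rewrite !linearP (tlift_linear mulSB) Sx Sy scalerDl scalerA.
rewrite ccomulM tlift_tmul //.
transitivity ((ccounit y : k) *: ((ccounit x : k) *: (1 : C))); last first.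
  by rewrite scalerA rmorphM mulrC.
rewrite -Sx [in RHS]/tlift /eval_sum scaler_sumr; apply: eq_bigr => q _.
rewrite -[in RHS](mul1r (cantipode q.2)) scalerAr scalerAl -Sy.
rewrite mulr_suml mulr_sumr; apply: eq_bigr => p _.
by rewrite cantipodeM !mulrA.
Qed.

Definition coef_hopf : hopfType k := HB.pack C
  (Algebra_isHopf.Build k C (@ccomul1 _ _ _ rho) (@ccomulM _ _ _ rho)
    (@ccomulA _ _ _ rho) (@ccounitl _ _ _ rho) (@ccounitr _ _ _ rho)
    cantipodel cantipoder).

End CoefficientHopf.

(** * Antipodes reverse products *)

Section Convolution.
Variables (k : fieldType) (H : hopfType k) (A : lmodType k) (m : A -> A -> A).
Hypothesis mB : bilinear_map m.

Definition convol (f g : H -> A) : H -> A :=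
  fun x => tlift (fun a b => m (f a) (g b)) (comul x).

Lemma convol_body_bilinear (f g : H -> A) : linear f -> linear g ->
  bilinear_map (fun a b => m (f a) (g b)).
Proof.
have [mL mR] := mB; move=> fL gL.
by split=> [x|y] c a b; [rewrite gL mL|rewrite /= fL mR].
Qed.

(** Associativity of [m] is only required on values of [f], [g] and [h], so that
    [m] may itself be a convolution product, which is associative on linear maps
    only. *)
Lemma convolA (f g h : H -> A) : linear f -> linear g -> linear h ->
  (forall a b c, m (f a) (m (g b) (h c)) = m (m (f a) (g b)) (h c)) ->
  forall x, convol f (convol g h) x = convol (convol f g) h x.
Proof.
move=> fL gL hL mA x; have [mL mR] := mB.
have ghB := convol_body_bilinear gL hL; have fgB := convol_body_bilinear fL gL.
have T3B : bilinear_map (fun a t => m (f a) (tlift (fun b c => m (g b) (h c)) t)).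
  split=> [a|t] c u v; first by rewrite (tlift_linear ghB) mL.
  by rewrite /= fL mR.
pose T3 := tlift (fun a t => m (f a) (tlift (fun b c => m (g b) (h c)) t)).
have T3L : linear T3 by apply: tlift_linear.
have assocL : linear (@tassoc k H H H) by apply/tlift_linear/tassoc_bilinear.
have comulL : linear (@comul k H) by apply: linearP.
transitivity (T3 (tmap idfun comul (comul x))).
  by rewrite /T3 tlift_tmap.
rewrite -comulA /tmap (linear_tlift _ _ assocL) (linear_tlift _ _ T3L).
apply: eq_tlift => a b; rewrite /convol /=.
have [pL pR] := pure_bilinear (tensor H H) H.
move: (comul a); apply: tensor_linear_eq => [c t t'|c t t'|u v].
- by rewrite pR assocL T3L.
- by rewrite (tlift_linear fgB) mR.
by rewrite tassoc_pure /T3 !tlift_pure.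
Qed.

End Convolution.

Section AntipodeProduct.
Variables (k : fieldType) (H : hopfType k).
Implicit Types x y : H.

Let mB := @mulr_bilinear k H.

Lemma antipode1 : antipode (1 : H) = 1.
Proof.
have := antipodel (1 : H); rewrite comul1 tlift_pure; last first.
  have [mL mR] := mB; split=> [x|y] c a b; first exact: mL.
  by rewrite /= linearP; apply: mR.
by rewrite mulr1 rmorph1 scale1r.
Qed.

Let counit_sumr x : \sum_(p <- repr (comul x)) (counit p.2 : k) *: p.1 = x.
Proof. exact: counitr. Qed.
Let counit_suml x : \sum_(p <- repr (comul x)) (counit p.1 : k) *: p.2 = x.
Proof. exact: counitl. Qed.

(** Let [F x y = S (x y)], [M x y = x y] and [R x y = S y S x]. In the
    convolution algebra of maps on [H (x) H] one has [F M = 1] and [M R = 1],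
    so that [F = F M R = R]. Currying makes this an instance of convolution on
    [H] twice. *)
Lemma antipodeM x y : antipode (x * y) = antipode y * antipode x.
Proof.
have [mL mR] := mB.
pose m2 (f g : H -> H) : H -> H := convol *%R f g.
pose F x : H -> H := fun y => antipode (x * y).
pose M x : H -> H := fun y => x * y.
pose R x : H -> H := fun y => antipode y * antipode x.
pose E x : H -> H := fun y => (counit x * counit y : k) *: 1.
have FL a : linear (F a) by move=> c u v; rewrite /F mL linearP.
have ML a : linear (M a) by apply: mL.
have RL a : linear (R a) by move=> c u v; rewrite /R linearP mR.
have FL' : linear F by move=> c u v; apply: funext => z; rewrite /F mR linearP.
have ML' : linear M by move=> c u v; apply: funext => z; apply: mR.
have RL' : linear R by move=> c u v; apply: funext => z; rewrite /R linearP mL.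
have m2B : bilinear_map m2.
  have sumP c z (f g h : H * H -> H) : (forall p, f p = c *: g p + h p) ->
      \sum_(p <- repr (comul z)) f p = c *: (\sum_(p <- repr (comul z)) g p) +
      \sum_(p <- repr (comul z)) h p.
    by move=> fgh; rewrite scaler_sumr -big_split; apply: eq_bigr.
  by split=> [f|g] c u v; apply: funext => z; apply: sumP => p; [apply: mL|apply: mR].
have convol2E f g u v : convol m2 f g u v =
    \sum_(p <- repr (comul u)) \sum_(q <- repr (comul v)) f p.1 q.1 * g p.2 q.2.
  exact: (lin_sum (f := fun h : H -> H => h v)).
have FM : convol m2 F M = E.
  apply: funext => u; apply: funext => v; rewrite convol2E /E -rmorphM.
  rewrite -antipodel comulM tlift_tmul //.
  by split=> [a|a] c b d; [apply: mL|rewrite /= linearP; apply: mR].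
have MR : convol m2 M R = E.
  apply: funext => u; apply: funext => v; rewrite convol2E /E.
  transitivity ((counit v : k) *: ((counit u : k) *: (1 : H))); last first.
    by rewrite scalerA mulrC.
  rewrite -antipoder scaler_sumr; apply: eq_bigr => p _.
  rewrite -[p.1 in RHS]mulr1 scalerAl scalerAr -antipoder mulr_sumr mulr_suml.
  by apply: eq_bigr => q _; rewrite /M /R !mulrA.
have FE u v : convol m2 F E u v = F u v.
  rewrite convol2E /F -{2}[u]counit_sumr -{2}[v]counit_sumr mulr_suml linear_sum.
  apply: eq_bigr => p _; rewrite mulr_sumr linear_sum; apply: eq_bigr => q _.
  by rewrite /E -scalerAr mulr1 -scalerAl -scalerAr scalerA linearZ.
have ER u v : convol m2 E R u v = R u v.
  rewrite convol2E /R -{2}[u]counit_suml -{2}[v]counit_suml !linear_sum mulr_sumr.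
  apply: eq_bigr => p _; rewrite mulr_suml; apply: eq_bigr => q _.
  by rewrite /E -scalerAl mul1r !linearZ -scalerAl -scalerAr scalerA mulrC.
rewrite -[LHS]/(F x y) -[RHS]/(R x y) -[LHS]FE -[RHS]ER -{1}MR -FM.
rewrite (convolA m2B) // => a b c; apply: funext => z.
exact: (convolA mB (FL a) (ML b) (RL c) (fun _ _ _ => mulrA _ _ _)).
Qed.
End AntipodeProduct.

(** * Entries of the given tensors *)

(** The product is a parameter because this applies to composition in [End(W)],
    which may be zero, to the product of an algebra, and to its opposite. *)
Lemma inverse_unique (k : fieldType) (n : nat) (A : lmodType k)
    (m : A -> A -> A) (one : A) (X Y Z : 'I_n -> 'I_n -> A) :
  bilinear_map m -> associative m -> left_id one m -> right_id one m ->
  (forall i j, \sum_l m (X i l) (Y l j) = (i == j)%:R *: one) ->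
  (forall i j, \sum_l m (Y i l) (Z l j) = (i == j)%:R *: one) ->
  forall i j, X i j = Z i j.
Proof.
move=> [mL mR] mA m1l m1r XY YZ i j.
transitivity (\sum_l m (X i l) (\sum_t m (Y l t) (Z t j))).
  rewrite (bigD1 j) //= YZ eqxx scale1r m1r big1 ?addr0 // => l lj.
  by rewrite YZ (negPf lj) scale0r (lin0 (mL _)).
under eq_bigr => l _ do rewrite (lin_sum (mL _)).
rewrite exchange_big (bigD1 i) //=; under eq_bigr => l _ do rewrite mA.
rewrite -(lin_sum (mR _)) XY eqxx scale1r m1l big1 ?addr0 // => t ti.
under eq_bigr => l _ do rewrite mA.
by rewrite -(lin_sum (mR _)) XY eq_sym (negPf ti) scale0r (lin0 (mR _)).
Qed.

Section TensorEntries.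
Variables (k : fieldType) (V W : vectType k).
Local Notation compV := (@comp_lfun _ V V V).
Local Notation compW := (@comp_lfun _ W W W).
Implicit Types x y : tensor 'End(V) 'End(W).

Lemma tmx_one i j :
  tmx (pure \1%VF \1%VF : tensor 'End(V) 'End(W)) i j = (i == j)%:R *: \1%VF.
Proof. by rewrite tmx_pure emx1 mxE. Qed.

Lemma tmx_inverse x y i j : tmul compV compW x y = pure \1%VF \1%VF ->
  \sum_l (tmx x i l \o tmx y l j)%VF = (i == j)%:R *: \1%VF.
Proof.
move=> /(congr1 (fun t => tmx t i j)); rewrite tmx_one => <-.
by rewrite tmx_tmul //; apply: comp_lfun_bilinear.
Qed.

Lemma transpose_linear : linear (@transpose k V).
Proof.
move=> c S T; apply/lfunP => f.
by rewrite add_lfunE scale_lfunE !transposeE comp_lfunDr comp_lfunZr.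
Qed.

Lemma transpose_comp S T :
  (transpose S \o transpose T)%VF = transpose (T \o S)%VF :> 'End(vdual V).
Proof. by apply/lfunP => f; rewrite comp_lfunE !transposeE comp_lfunA. Qed.

Lemma transpose1 : transpose \1%VF = \1%VF :> 'End(vdual V).
Proof. by apply/lfunP => f; rewrite transposeE comp_lfun1r id_lfunE. Qed.

(** The matrix of [T] can be read off its transpose: its entries are the values
    of [transpose T] at a coordinate form and a basis vector. *)
Definition coord_form (i : 'I_(dim V)) : vdual V :=
  linfun (fun x : V => v2r x 0 i : k^o).
Definition tentry (T : 'End(vdual V)) i j : k :=
  (T (coord_form i) : vdual V) (r2v (delta_mx 0 j)).

Lemma tentry_transpose T i j : tentry (transpose T) i j = emx T i j.
Proof.
rewrite /tentry transposeE comp_lfunE mxE.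
have fL : linear (fun x : V => v2r x 0 i : k^o).
  by move=> c x y; rewrite linearP !mxE.
pose f := HB.pack_for {linear V -> k^o} (fun x : V => v2r x 0 i : k^o)
  (GRing.isLinear.Build k _ _ _ _ fL).
exact: (lfunE f).
Qed.

Lemma tentry_bilinear i j :
  bilinear_map (fun (T : 'End(vdual V)) (a : 'End(W)) => tentry T i j *: a).
Proof.
split=> [T|a] c x y; first by rewrite scalerDr !scalerA [_ * c]mulrC.
by rewrite /tentry !lfun_simp scalerDl scalerA.
Qed.

(** Transposition reverses composition, on the first leg only. Hence an inverse
    of the transposed tensor satisfies the inversion formula in which the two
    matrix indices, but not the compositions in [End(W)], are exchanged. *)
Lemma tmx_inverse_transpose x y i j :
  tmul (@comp_lfun _ (vdual V) (vdual V) (vdual V)) compW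
    (tmap (@transpose k V) idfun x) (tmap (@transpose k V) idfun y) =
    pure \1%VF \1%VF ->
  \sum_l (tmx x l j \o tmx y i l)%VF = (i == j)%:R *: \1%VF.
Proof.
pose F := tlift (fun (T : 'End(vdual V)) (a : 'End(W)) => tentry T i j *: a).
have FL : linear F by apply/tlift_linear/tentry_bilinear.
have cB := comp_lfun_bilinear W; have [cL cR] := cB.
have [tL tR] := tmul_bilinear (comp_lfun_bilinear (vdual V)) cB.
have mapL := tmap_linear transpose_linear (@id_linear _ 'End(W)).
move=> /(congr1 F); rewrite /F tlift_pure; last exact: tentry_bilinear.
rewrite -transpose1 tentry_transpose emx1 mxE => <-; rewrite -/F.
apply: (tensor_linear_eq (f := fun x => \sum_l (tmx x l j \o tmx y i l)%VF)
  (g := fun x => F (tmul _ _ (tmap _ _ x) (tmap _ _ y)))) x => [c a b|c a b|T a].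
- rewrite scaler_sumr -big_split; apply: eq_bigr => l _.
  by rewrite (tmx_linear l j) (cR (tmx y i l)).
- by rewrite mapL tR FL.
apply: (tensor_linear_eq
  (f := fun y => \sum_l (tmx (pure T a) l j \o tmx y i l)%VF)
  (g := fun y => F (tmul _ _ (tmap _ _ (pure T a)) (tmap _ _ y)))) y =>
  [c b b'|c b b'|T' b].
- rewrite scaler_sumr -big_split; apply: eq_bigr => l _.
  by rewrite (tmx_linear i l) (cL (tmx (pure T a) l j)).
- by rewrite mapL tL FL.
rewrite !tmap_pure ?tmul_pure //; try exact: transpose_linear;
  try exact: comp_lfun_bilinear.
rewrite /F tlift_pure; last exact: tentry_bilinear.
rewrite transpose_comp tentry_transpose emx_comp mxE scaler_suml.
apply: eq_bigr => l _.
by rewrite !tmx_pure (linZ (cR _)) (linZ (cL _)) scalerA mulrC.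
Qed.

End TensorEntries.

Section Coefficients.
Variables (k : fieldType) (V : vectType k).

Fact emx_form_linear i j : linear (fun T : 'End(V) => emx T i j : k^o).
Proof. by move=> c S T; rewrite emx_linear !mxE. Qed.
Definition emx_form i j : dual 'End(V) := dual_of (emx_form_linear i j).

Lemma tmx_coef (H : hopfType k) (v : tensor 'End(V) H) i j :
  corep_coef v (tmx v i j).
Proof. by exists (emx_form i j). Qed.

Lemma corep_coef_tmx (H : hopfType k) (v : tensor 'End(V) H) x :
  corep_coef v x ->
  exists c : 'I_(dim V) -> 'I_(dim V) -> k,
    x = \sum_i \sum_j c i j *: tmx v i j.
Proof.
case=> f ->; exists (fun i j => f (eunit i j)); apply: tlift_tmx.
split=> [T|a] c x1 x2; first by rewrite scalerDr !scalerA [_ * c]mulrC.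
by rewrite linearP scalerDl scalerA.
Qed.

End Coefficients.

Section Letters.
Variables (k : fieldType) (V W : vectType k) (u u' : tensor 'End(V) 'End(W)).
Local Notation n := (dim V).
Local Notation m := (dim W).

Definition tensor_rho (l : letter m) : 'M[k]_n :=
  let: (e, p, q) := l in
  \matrix_(i, j) if e then emx (tmx u' i j) q p else emx (tmx u i j) p q.

Hypotheses (hu : inverse_of u u')
  (ht : inverse_of (tmap (@transpose k V) idfun u)
                   (tmap (@transpose k V) idfun u')).

Lemma tensor_rhoP : flip_inverse tensor_rho.
Proof.
have E (X Y : 'I_n -> 'I_n -> 'I_n -> 'End(W)) i j p q :
    \sum_l (X i j l \o Y i j l)%VF = (i == j)%:R *: \1%VF ->
    \sum_r \sum_l emx (X i j l) p r * emx (Y i j l) r q = (p == q)%:R * (i == j)%:R.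
  move=> /(congr1 (fun T => emx T p q)); rewrite (lin_sum (@emx_linear k W)).
  rewrite (linZ (@emx_linear k W)) emx1 !mxE mulrC => <-; rewrite summxE exchange_big.
  by apply: eq_bigr => l _; rewrite emx_comp mxE.
have D (p q : 'I_m) (i j : 'I_n) :
    ((p == q)%:R%:M : 'M[k]_n) i j = (p == q)%:R * (i == j)%:R.
  by rewrite mxE mulr_natr.
case: hu ht => hu1 hu2 [ht1 ht2].
split=> e p q; apply/matrixP => i j; rewrite D summxE.
- under eq_bigr => r _ do rewrite mxE.
  case: e => /=.
    rewrite [p == q]eq_sym.
    rewrite -(E (fun i j l => tmx u' l j) (fun i j l => tmx u i l) _ _ _ _
      (tmx_inverse_transpose i j ht2)).
    by apply: eq_bigr => r _; apply: eq_bigr => l _; rewrite !mxE mulrC.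
  rewrite -(E (fun i j l => tmx u' i l) (fun i j l => tmx u l j) _ _ _ _
      (tmx_inverse i j hu2)).
  by apply: eq_bigr => r _; apply: eq_bigr => l _; rewrite !mxE.
- under eq_bigr => r _ do rewrite mxE.
  case: e => /=.
    rewrite [p == q]eq_sym.
    rewrite -(E (fun i j l => tmx u l j) (fun i j l => tmx u' i l) _ _ _ _
      (tmx_inverse_transpose i j ht1)).
    by apply: eq_bigr => r _; apply: eq_bigr => l _; rewrite !mxE mulrC.
  rewrite -(E (fun i j l => tmx u i l) (fun i j l => tmx u' l j) _ _ _ _
      (tmx_inverse i j hu1)).
  by apply: eq_bigr => r _; apply: eq_bigr => l _; rewrite !mxE.
Qed.

End Letters.

(** * The coefficient model *)

Section CoefficientModel.
Variables (k : fieldType) (V W : vectType k) (u u' : tensor 'End(V) 'End(W)).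
Hypotheses (hu : inverse_of u u')
  (ht : inverse_of (tmap (@transpose k V) idfun u)
                   (tmap (@transpose k V) idfun u')).
Local Notation n := (dim V).
Local Notation m := (dim W).
Local Notation rho := (tensor_rho u u').
Local Notation rhoP := (tensor_rhoP hu ht).
Local Notation C := (coef_hopf rhoP).

Definition ccorep : tensor 'End(V) C :=
  \sum_i \sum_j pure (eunit i j) (cgen rho false i j : C).

Definition crep (x : C) : 'End(W) :=
  mxe (\matrix_(p, q) ev (x : coef_alg rho) [:: (false, p, q)]).

Fact crep_linear : linear crep.
Proof.
move=> c x y; apply: (can_inj (@emxK _ _)); rewrite emx_linear !mxeK.
by apply/matrixP => p q; rewrite !mxE.
Qed.
HB.instance Definition _ := GRing.isLinear.Build k C 'End(W) *:%R crep crep_linear.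

Lemma emx_crep x p q : emx (crep x) p q = ev (x : coef_alg rho) [:: (false, p, q)].
Proof. by rewrite mxeK mxE. Qed.

Lemma tmx_ccorep i j : tmx ccorep i j = cgen rho false i j.
Proof. exact: tmx_of_sum. Qed.

Fact ccorepP : corepresentation ccorep.
Proof.
have mB := @mulr_bilinear _ C.
split; apply: tmx_inj => i j.
  rewrite tmx_tmap; last exact: linearP.
  rewrite tmx_tmul; last exact: tmul_bilinear.
  rewrite tmx_ccorep [LHS]ccomul_cgen; apply: eq_bigr => l _.
  have [pL pR] := pure_bilinear C C.
  rewrite (tmx_tmap _ _ _ (pR 1)) (tmx_tmap _ _ _ (pL 1)) !tmx_ccorep.
  by rewrite tmul_pure // mulr1 mul1r.
rewrite tmx_tmap; last exact: linearP.
rewrite tmx_ccorep tmx_pure emx1 mxE [LHS]ccounit_cgen.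
by rewrite -[RHS]/(_ * 1) mulr1.
Qed.

Fact crepP : representation crep.
Proof.
split=> [|x y]; apply: (can_inj (@emxK _ _)); apply/matrixP => p q;
    rewrite emx_crep.
  by rewrite emx1 mxE -[LHS]/((1 : wfun k m) [:: (false, p, q)]) wone_cons mulr1.
by rewrite emx_comp mxE; apply: eq_bigr => r _; rewrite !emx_crep.
Qed.

Fact coef_modelE : tmap idfun crep ccorep = u.
Proof.
apply: tmx_inj => i j; rewrite (tmx_tmap _ _ _ crep_linear) tmx_ccorep.
apply: (can_inj (@emxK _ _)); apply/matrixP => p q.
by rewrite emx_crep /ev /= mulmx1 mxE.
Qed.

Definition coef_model : model u := Model ccorepP crepP coef_modelE.

Lemma coef_model_left_faithful : left_faithful coef_model.
Proof.
apply/seteqP; split => // x _.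
elim/(@coef_ind _ _ _ rho) : x => [e i j||c x y gx gy|x y gx gy].
(* The generator with [e] true is the antipode of the one with [e] false. *)
- apply: subalg_gen_in; exists (nat_of_bool e) => //.
  exists (cgen rho false i j : C).
    by rewrite -tmx_ccorep; apply: tmx_coef.
  case: e => //; exact: cantipode_cgen.
- exact: subalg_gen_one.
- exact/subalg_gen_add/gy/subalg_gen_scale.
- exact: subalg_gen_mul.
Qed.

Definition letter_form (l : letter m) : dual C :=
  dual_of (ev_linear (rho := rho) [:: l]).

Lemma letter_form_gen l :
  hopf_gen (@dual_antipode k C) (rep_coef crep) (letter_form l).
Proof.
have form_false p q : rep_coef crep (letter_form (false, p, q)).
  by exists (emx_form p q) => h; rewrite /= emx_crep.
apply: subalg_gen_in; case: l => [[e p] q].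
exists (nat_of_bool e) => //; case: e => /=; last by exists (letter_form (false, p, q)).
exists (letter_form (false, q, p)) => //.
exact: dual_ext.
Qed.

(** Evaluation at a word is the convolution product of the evaluations at its
    letters, which are coefficients of the representation or antipodes of such
    coefficients. *)
Lemma coef_model_right_faithful : right_faithful coef_model.
Proof.
move=> x x0; apply: ev_inj => w.
have [f [fgen fE]] : exists f : dual C,
    hopf_gen (@dual_antipode k C) (rep_coef crep) f /\
    forall y, f y = ev (y : coef_alg rho) w.
  elim: w => [|l w [f [fgen fE]]].
    by exists 1; split=> //; apply: subalg_gen_one.
  exists (letter_form l * f); split; first exact/subalg_gen_mul/fgen/letter_form_gen.
  move=> y; rewrite dual_mulE -(ev2_comul [:: l] w y); apply: eq_tlift => a b.
  by rewrite fE.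
by rewrite -fE x0.
Qed.

End CoefficientModel.

(** * Mapping a model to functions on words *)

Section ToWords.
Variables (k : fieldType) (V W : vectType k) (u u' : tensor 'End(V) 'End(W)).
Hypotheses (hu : inverse_of u u')
  (ht : inverse_of (tmap (@transpose k V) idfun u)
                   (tmap (@transpose k V) idfun u')).
Variables (N : model u).
Local Notation n := (dim V).
Local Notation m := (dim W).
Local Notation rho := (tensor_rho u u').
Local Notation rhoP := (tensor_rhoP hu ht).
Local Notation H := (model_hopf N).
Local Notation P := (wfun k m).
Local Notation pi := (model_rep N).
Implicit Types h x y : H.

Definition mentry i j : H := tmx (model_corep N) i j.

Lemma comul_mentry i j :
  comul (mentry i j) = \sum_l pure (mentry i l) (mentry l j).
Proof.
have [/(congr1 (fun t => tmx t i j)) + _] := model_corepP N.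
have mB := @mulr_bilinear _ H; have [pL pR] := pure_bilinear H H.
rewrite tmx_tmap; last exact: linearP.
rewrite tmx_tmul; last exact: tmul_bilinear.
move=> ->; apply: eq_bigr => l _.
by rewrite (tmx_tmap _ _ _ (pR 1)) (tmx_tmap _ _ _ (pL 1)) tmul_pure // mulr1 mul1r.
Qed.

Lemma counit_mentry i j : counit (mentry i j) = (i == j)%:R.
Proof.
have [_ /(congr1 (fun t => tmx t i j))] := model_corepP N.
rewrite tmx_tmap; last exact: linearP.
by rewrite tmx_pure emx1 mxE => ->; rewrite -[LHS]/(_ * 1) mulr1.
Qed.

Lemma rep_mentry i j : pi (mentry i j) = tmx u i j.
Proof.
rewrite -[in RHS](modelE N) tmx_tmap //; exact: linearP.
Qed.

Lemma antipode_mentry i j :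
  \sum_l antipode (mentry i l) * mentry l j = (i == j)%:R *: 1.
Proof.
have SB : bilinear_map (fun x y : H => antipode x * y).
  have [mL mR] := @mulr_bilinear _ H.
  by split=> [x|y] c a b; [apply: mL|rewrite /= linearP; apply: mR].
rewrite -counit_mentry -antipodel comul_mentry (lin_sum (tlift_linear SB)).
by apply: eq_bigr => l _; rewrite tlift_pure.
Qed.

(** Both [pi (S v)] and [u'] are inverse to [u], from different sides. *)
Lemma rep_antipode_mentry i j : pi (antipode (mentry i j)) = tmx u' i j.
Proof.
have [pi1 piM] := model_repP N.
apply: (inverse_unique (@comp_lfun_bilinear _ W) (@comp_lfunA _ _ _ _ _)
  (@comp_lfun1l _ _ _) (@comp_lfun1r _ _ _)
  (X := fun i j => pi (antipode (mentry i j))) (Y := fun i j => tmx u i j)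
  (Z := fun i j => tmx u' i j)) => {}i {}j; last exact: tmx_inverse hu.1.
under eq_bigr => l _ do rewrite -rep_mentry -piM.
by rewrite -linear_sum antipode_mentry linearZ pi1.
Qed.

Definition lform_fun (l : letter m) h : k^o :=
  let: (e, p, q) := l in
  if e then emx (pi (antipode h)) q p else emx (pi h) p q.

Fact lform_linear l : linear (lform_fun l).
Proof.
by case: l => [[[] p] q] c x y; rewrite /= !linearP emx_linear !mxE.
Qed.
Definition lform l : dual H := dual_of (lform_linear l).

(** When [e] is true, the reversal of products by the antipode is compensated by
    the exchange of [p] and [q] in [lform_fun]. *)
Lemma lformM e p q x y :
  lform (e, p, q) (x * y) = \sum_r lform (e, p, r) x * lform (e, r, q) y.
Proof.
have [_ piM] := model_repP N.
case: e => /=; rewrite ?antipodeM piM emx_comp mxE //.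
by apply: eq_bigr => r _; rewrite mulrC.
Qed.

Lemma lform1 e p q : lform (e, p, q) 1 = (p == q)%:R.
Proof.
have [pi1 _] := model_repP N.
by case: e => /=; rewrite ?antipode1 pi1 emx1 mxE // eq_sym.
Qed.

Lemma lform_mentry l i j : lform l (mentry i j) = rho l i j.
Proof.
by case: l => [[[] p] q]; rewrite /= mxE ?rep_antipode_mentry ?rep_mentry.
Qed.

(** A morphism from the free algebra on the letters to the dual of [H]; the map
    [to_words] below is its transpose. *)
Definition word_form (w : seq (letter m)) : dual H := \prod_(l <- w) lform l.
Definition to_words h : P := fun w => word_form w h.

Lemma to_words_linear : linear to_words.
Proof. by move=> c x y; apply: funext => w; rewrite /to_words linearP. Qed.

Lemma to_words_nil h : to_words h [::] = counit h.
Proof. by rewrite /to_words /word_form big_nil. Qed.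

Lemma shift_to_words l h :
  shift l (to_words h) = \sum_(p <- repr (comul h)) lform l p.1 *: to_words p.2.
Proof.
apply: funext => w; rewrite wfun_sum /shift /to_words /word_form big_cons.
by rewrite dual_mulE.
Qed.

Lemma to_words_cat h w w' :
  to_words h (w ++ w') =
  tlift (fun x y => to_words x w * to_words y w' : k^o) (comul h).
Proof. by rewrite /to_words /word_form big_cat dual_mulE. Qed.

Lemma to_words1 : to_words 1 = 1.
Proof.
apply: funext; elim=> [|[[e p] q] w IHw].
  by rewrite to_words_nil rmorph1.
rewrite -cat1s to_words_cat comul1 tlift_pure; last first.
  by apply: mul_functionals_bilinear => c x y; rewrite to_words_linear.
by rewrite IHw wone_cons /to_words /word_form big_seq1 lform1.
Qed.

Lemma to_wordsM x y : to_words (x * y) = to_words x * to_words y.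
Proof.
apply: funext => w; elim: w x y => [|[[e p] q] w IHw] x y.
  by rewrite wmul_nil !to_words_nil rmorphM.
rewrite -cat1s to_words_cat comulM tlift_tmul; last first.
  by apply: mul_functionals_bilinear => c a b; rewrite to_words_linear.
rewrite wmul_cons; under [RHS]eq_bigr => r _.
  rewrite !shift_to_words mulr_suml wfun_sum.
  under eq_bigr => a _.
    rewrite mulr_sumr wfun_sum.
    under eq_bigr => b _ do rewrite -scalerAl -scalerAr scalerA wfunZ -IHw.
    over.
  over.
rewrite [RHS]exchange_big; apply: eq_bigr => a _.
rewrite [RHS]exchange_big; apply: eq_bigr => b _.
by rewrite -mulr_suml -lformM /to_words /word_form big_seq1.
Qed.

Lemma to_words_mentry i j : to_words (mentry i j) = gen rho false i j.
Proof.
apply: funext => w; elim: w i j => [|l w IHw] i j.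
  by rewrite to_words_nil counit_mentry /= mxE.
rewrite -cat1s to_words_cat comul_mentry /= mxE.
have B : bilinear_map (fun x y => to_words x [:: l] * to_words y w : k^o).
  by apply: mul_functionals_bilinear => c a b; rewrite to_words_linear.
rewrite (lin_sum (tlift_linear B)); apply: eq_bigr => s _.
by rewrite tlift_pure // IHw /to_words /word_form big_seq1 lform_mentry.
Qed.

(** ** Compatibility with antipodes *)

Definition mulswap (A : pzRingType) (b : bool) (x y : A) := if b then y * x else x * y.

(** Applying the antipode to the inversion formula for [S^a v] yields the one
    for [S^(a+1) v], with the two factors of each product exchanged. *)
Lemma iter_antipode_mentry a i j :
  \sum_l mulswap (odd a) (iter a.+1 antipode (mentry i l))
                         (iter a antipode (mentry l j)) = (i == j)%:R *: 1.
Proof.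
elim: a => [|a IHa]; first exact: antipode_mentry.
have := congr1 antipode IHa; rewrite linear_sum linearZ antipode1 => <-.
by apply: eq_bigr => l _; rewrite /mulswap /=; case: (odd a); rewrite /= antipodeM.
Qed.

Lemma gen_mulswap b i j :
  \sum_l mulswap b (gen rho b i l) (gen rho (~~ b) l j) = (i == j)%:R *: 1.
Proof.
case: b.
- have := congr1 (@coef_val _ _ _ rho) (genmx_mul_trE rhoP true i j).
  by rewrite (lin_sum (@coef_val_linear _ _ _ rho)).
have := congr1 (@coef_val _ _ _ rho) (genmx_mulE rhoP true i j).
by rewrite (lin_sum (@coef_val_linear _ _ _ rho)).
Qed.

(** By induction the image of [S^a v] is [gen (odd a)]. The image of [S^(a+1) v]
    and the matrix [gen (~~ odd a)] are inverse to it, from different sides and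
    for the same product, so that they agree. *)
Lemma to_words_iter_antipode a i j :
  to_words (iter a antipode (mentry i j)) = gen rho (odd a) i j.
Proof.
elim: a i j => [|a IHa] i j; first exact: to_words_mentry.
have mB := @mulr_bilinear _ P.
apply: (@inverse_unique _ _ _ (mulswap (odd a)) 1
  (fun i j => to_words (iter a.+1 antipode (mentry i j)))
  (fun i j => gen rho (odd a) i j)) => {i j}.
- by case: (odd a) => //; case: mB.
- by case: (odd a) => x y z /=; rewrite mulrA.
- by case: (odd a) => x; rewrite /mulswap ?mulr1 ?mul1r.
- by case: (odd a) => x; rewrite /mulswap ?mulr1 ?mul1r.
- move=> i j; have := congr1 to_words (iter_antipode_mentry a i j).
  rewrite (lin_sum to_words_linear) (linZ to_words_linear) to_words1 => <-.
  apply: eq_bigr => l _; rewrite -IHa /mulswap.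
  by case: (odd a); rewrite to_wordsM.
- exact: gen_mulswap.
Qed.

Hypothesis N_left : left_faithful N.

(** Since [N] is left-faithful, it suffices to consider the entries of [S^a v],
    where [to_words_iter_antipode] applies, and products, which are reversed by
    both antipodes. *)
Lemma to_words_coef h :
  coef_pred rho (to_words h) /\ to_words (antipode h) = wflip (to_words h).
Proof.
pose Q x := coef_pred rho (to_words x) /\ to_words (antipode x) = wflip (to_words x).
have QD x y : Q x -> Q y -> Q (x + y).
  by case=> gx Sx [gy Sy]; rewrite /Q linearD !(linD to_words_linear) Sx Sy;
    split=> //; apply: rpredD.
have QZ c x : Q x -> Q (c *: x).
  by case=> gx Sx; rewrite /Q linearZ !(linZ to_words_linear) Sx;
    split=> //; apply: rpredZ.
have Q1 : Q 1.
  by rewrite /Q antipode1 to_words1 wflip1; split=> //; apply: rpred1.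
have Q0 : Q 0 by rewrite -(scale0r 1); apply: QZ.
have : hopf_gen antipode (corep_coef (model_corep N)) h by rewrite N_left.
elim=> {h} [h [a _ [x /corep_coef_tmx [c ->] <-]]||x y _ Qx _ Qy
           |c x _ Qx|x y _ [gx Sx] _ [gy Sy]] //; [|exact: QD|exact: QZ|].
- have itL : linear (iter a (@antipode k H)).
    by elim: a => // a IHa d z z'; rewrite iterS IHa linearP.
  rewrite (lin_sum itL); elim/big_ind: _ => // i _.
  rewrite (lin_sum itL); elim/big_ind: _ => // j _.
  rewrite (linZ itL); apply: QZ; rewrite /Q -iterS !to_words_iter_antipode.
  by split; [apply: gen_coef|rewrite wflip_gen].
- by rewrite antipodeM !to_wordsM Sx Sy wflipM; split=> //; apply: rpredM.
Qed.

(** ** The morphism to the coefficient model *)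

Definition to_coef h : coef_alg rho := CoefAlg (to_words_coef h).1.

Fact to_coef_linear : linear to_coef.
Proof. by move=> c x y; apply: coef_val_inj; apply: to_words_linear. Qed.
Fact to_coefM : {morph to_coef : x y / x * y}.
Proof. by move=> x y; apply: coef_val_inj; apply: to_wordsM. Qed.
Fact to_coef1 : to_coef 1 = 1.
Proof. by apply: coef_val_inj; apply: to_words1. Qed.

Definition to_coef_morphism : {lrmorphism H -> coef_hopf rhoP} :=
  HB.pack_for {lrmorphism H -> coef_hopf rhoP} to_coef
    (GRing.isLinear.Build k H (coef_hopf rhoP) *:%R to_coef to_coef_linear)
    (GRing.isMonoidMorphism.Build H (coef_hopf rhoP) to_coef (conj to_coef1 to_coefM)).

Lemma to_coef_model_morphism :
  @model_morphism _ _ _ u N (coef_model hu ht) to_coef_morphism.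
Proof.
split.
- split=> h.
  + apply: ev2_inj => w w'; rewrite [LHS]ev2_comul [LHS]to_words_cat.
    symmetry; rewrite /ev2 tlift_tmap //; try exact: to_coef_linear.
    exact: ev2_bilinear.
  + exact: to_words_nil.
  + by apply: coef_val_inj; rewrite [RHS](to_words_coef h).2.
- apply: tmx_inj => i j; rewrite tmx_tmap; last exact: to_coef_linear.
  by rewrite tmx_ccorep; apply: coef_val_inj; apply: to_words_mentry.
move=> h; apply: (can_inj (@emxK _ _)); apply/matrixP => p q.
by rewrite emx_crep /ev /= /to_words /word_form big_seq1.
Qed.

End ToWords.

(** * Morphisms of models *)

Section ModelMorphisms.
Variables (k : fieldType) (V W : vectType k) (u : tensor 'End(V) 'End(W)).
Implicit Types M N : model u.

Lemma hopf_morphism_iter_antipode (H K : hopfType k) (f : {lrmorphism H -> K}) a x :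
  hopf_morphism f -> f (iter a antipode x) = iter a antipode (f x).
Proof. by case=> _ _ fS; elim: a => //= a IHa; rewrite -fS IHa. Qed.

(** The values at the entries of [v] are imposed, those at their iterated
    antipodes follow, and these elements generate. *)
Lemma model_morphism_unique M N (f g : {lrmorphism model_hopf N -> model_hopf M}) :
  left_faithful N -> model_morphism f -> model_morphism g -> g =1 f.
Proof.
move=> Nl [fH fv _] [gH gv _] h.
have fL : linear f by apply: linearP.
have gL : linear g by apply: linearP.
have fMul : {morph f : x y / x * y} by apply: rmorphM.
have gMul : {morph g : x y / x * y} by apply: rmorphM.
have : hopf_gen antipode (corep_coef (model_corep N)) h by rewrite Nl.
elim=> {h} [h [a _ [x /corep_coef_tmx [c ->] <-]]||x y _ fgx _ fgy
           |c x _ fgx|x y _ fgx _ fgy].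
- rewrite !hopf_morphism_iter_antipode //; congr (iter a antipode _).
  rewrite !linear_sum; apply: eq_bigr => i _.
  rewrite !linear_sum; apply: eq_bigr => j _.
  have E (e : {lrmorphism model_hopf N -> model_hopf M}) :
      tmap idfun e (model_corep N) = model_corep M ->
      e (tmx (model_corep N) i j) = tmx (model_corep M) i j.
    by move=> <-; rewrite tmx_tmap //; apply: linearP.
  rewrite !linearZ; congr (_ *: _); exact: etrans (E g gv) (esym (E f fv)).
- by rewrite !rmorph1.
- by rewrite (linD gL) (linD fL) fgx fgy.
- by rewrite (linZ gL) (linZ fL) fgx.
- by rewrite fMul gMul fgx fgy.
Qed.

Lemma model_morphism_surj M N (f : {lrmorphism model_hopf N -> model_hopf M}) :
  left_faithful M -> model_morphism f -> forall y, exists x, f x = y.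
Proof.
move=> Ml [fH fv _] y.
have : hopf_gen antipode (corep_coef (model_corep M)) y by rewrite Ml.
elim=> {y} [y [a _ [x /corep_coef_tmx [c ->] <-]]||x y _ [x' <-] _ [y' <-]
           |c x _ [x' <-]|x y _ [x' <-] _ [y' <-]].
- exists (iter a antipode (\sum_i \sum_j c i j *: tmx (model_corep N) i j)).
  rewrite hopf_morphism_iter_antipode //; congr (iter a antipode _).
  rewrite linear_sum; apply: eq_bigr => i _; rewrite linear_sum; apply: eq_bigr => j _.
  by rewrite linearZ -fv tmx_tmap //; apply: linearP.
- by exists 1; rewrite rmorph1.
- by exists (x' + y'); rewrite linearD.
- by exists (c *: x'); rewrite linearZ.
- by exists (x' * y'); rewrite rmorphM.
Qed.

(** A coefficient of the representation of [N] is the pullback of one of [M],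
    and pulling linear forms back along [f] respects convolution and
    antipodes; so all elements of the algebra generated on the side of [N]
    vanish on the kernel of [f]. *)
Lemma model_morphism_inj M N (f : {lrmorphism model_hopf N -> model_hopf M}) :
  right_faithful N -> model_morphism f -> injective f.
Proof.
move=> Nr [[fD fe fS] _ fpi] x y fxy; apply/subr0_eq/Nr => g gg.
have fL : linear f by apply: linearP.
suff [g' gE] : exists g' : dual (model_hopf M), forall h, g h = g' (f h).
  by rewrite gE addrC -scaleN1r fL fxy scaleN1r addNr linear0.
elim: gg => {g} [g [a _ [g0 [g' gE] <-]]||g1 g2 _ [g1' E1] _ [g2' E2]
            |c g _ [g' E]|g1 g2 _ [g1' E1] _ [g2' E2]].
- have gL : linear (fun z => g' (model_rep M z)) by move=> c z z'; rewrite !linearP.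
  exists (iter a (@dual_antipode _ _) (dual_of gL)) => h.
  elim: a h => [|a IHa] h /=; first by rewrite gE fpi.
  by rewrite IHa fS.
- by exists 1 => h; rewrite !dual_oneE fe.
- by exists (g1' + g2') => h; rewrite [LHS]/(_ + _) E1 E2.
- by exists (c *: g') => h; rewrite [LHS]/(_ *: _) E.
- exists (g1' * g2') => h; rewrite !dual_mulE fD tlift_tmap //.
    by apply: eq_tlift => b b'; rewrite E1 E2.
  by apply: mul_functionals_bilinear => c z z'; rewrite linearP.
Qed.

Lemma bijective_model_morphism_iso M N
    (f : {lrmorphism model_hopf N -> model_hopf M}) :
  model_morphism f -> injective f -> (forall y, exists x, f x = y) -> model_iso N M.
Proof.
move=> fM f_inj f_surj; have [[fD fe fS] fv fpi] := fM.
have fL : linear f by apply: linearP.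
have fMul : {morph f : x y / x * y} by apply: rmorphM.
pose g y := projT1 (cid (f_surj y)).
have fgK y : f (g y) = y by rewrite /g; case: cid.
have gfK x : g (f x) = x by apply: f_inj; rewrite fgK.
have gL : linear g by move=> c x y; apply: f_inj; rewrite fL !fgK.
have g1 : g 1 = 1 by apply: f_inj; rewrite fgK rmorph1.
have gX : {morph g : x y / x * y} by move=> x y; apply: f_inj; rewrite fMul !fgK.
pose gl := HB.pack_for {lrmorphism model_hopf M -> model_hopf N} g
  (GRing.isLinear.Build k _ _ *:%R g gL)
  (GRing.isMonoidMorphism.Build _ _ g (conj g1 gX)).
exists f, gl; split=> //; split.
- split=> y.
  + rewrite -[in RHS](fgK y) fD.
    move: (comul _); apply: tensor_linear_eq => [//|c a b|a b].
      by rewrite (tmap_linear fL fL) (tmap_linear gL gL).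
    by rewrite !tmap_pure //= !gfK.
  + by rewrite -[in RHS](fgK y) fe.
  + by apply: f_inj; rewrite /= -fS !fgK.
- apply: tmx_inj => i j; rewrite tmx_tmap // -fv tmx_tmap //; exact: gfK.
- by move=> y; rewrite fpi /= fgK.
Qed.

End ModelMorphisms.

Theorem theorem2p1 (k : fieldType) (V W : vectType k)
    (u u' : tensor 'End(V) 'End(W))
    (hu : inverse_of u u')
    (ht : inverse_of (tmap (@transpose k V) idfun u)
                     (tmap (@transpose k V) idfun u')) :
  exists M : model u,
    [/\ minimal_model M,
        bi_faithful M
      & forall N : model u, bi_faithful N -> model_iso N M].
Proof.
have Ml := coef_model_left_faithful hu ht.
exists (coef_model hu ht); split.
- split=> // N Nl; have fM := to_coef_model_morphism hu ht Nl.
  exists (to_coef_morphism hu ht Nl) => // g gM; exact: model_morphism_unique.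
- split=> //; exact: coef_model_right_faithful.
move=> N [Nl Nr]; have fM := to_coef_model_morphism hu ht Nl.
apply: (bijective_model_morphism_iso fM); first exact: model_morphism_inj.
exact: model_morphism_surj.
Qed.
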